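(* Let $X$, $A$ and $Y$ be $C^\infty$ manifolds, let $Z$ be a $C^\infty$ submanifold of $Y$, and let $F:U\to Y$ be a $C^\infty$ mapping, where $U$ is an open set of $X\times A$. Then the following $(\alpha)$ and $(\beta)$ are equivalent. $(\alpha)$ The set $\pi_2(W(F,Z))$ has Lebesgue measure zero in $\pi_2(U)$, where $\pi_2:U\to A$ is the natural projection $\pi_2(x,a)=a$. $(\beta)$ The mapping $F$ is generically transverse to $Z$.
   Context: All manifolds are without boundary and have countable bases. Transversality: for $C^\infty$ manifolds $X,Y$, a $C^\infty$ submanifold $Z$ of $Y$ and a $C^1$ mapping $f:X\to Y$, $f$ is transverse to $Z$ at $x\in X$ if either $f(x)\notin Z$, or $f(x)\in Z$ and $df_x(T_xX)+T_{f(x)}Z=T_{f(x)}Y$. The mapping $f$ is transverse to $Z$ if it is transverse to $Z$ at every $x\in X$. The quantity $\delta$: for such $f$, $Z$ and $x\in X$, set $\delta(f,x,Z)=0$ if $f(x)\notin Z$, and $\delta(f,x,Z)=\dim Y-\dim\bigl(df_x(T_xX)+T_{f(x)}Z\bigr)$ if $f(x)\in Z$. For a mapping $F:U\to Y$ on an open set $U\subset X\times A$, $\delta(F,(x,a),Z)$ is obtained by regarding $F$ as a mapping from the manifold $U$, at the point $(x,a)\in U$. Slices: let $\pi_1:U\to X$, $\pi_1(x,a)=x$, and $\pi_2:U\to A$, $\pi_2(x,a)=a$, be the natural projections. For $a\in\pi_2(U)$, $F_a:\pi_1(U\cap(X\times\{a\}))\to Y$ is the mapping $F_a(x)=F(x,a)$,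 defined on an open set of $X$; $\delta(F_a,x,Z)$ is computed for this mapping. Generic transversality: a $C^1$ mapping $F:U\to Y$ is generically transverse to $Z$ if there exists a Lebesgue measure zero set $\Sigma$ of $\pi_2(U)$ such that for every $a\in\pi_2(U)-\Sigma$, the mapping $F_a$ is transverse to $Z$. Finally, $W(F,Z)=\{(x,a)\in U\mid \delta(F_a,x,Z)=\delta(F,(x,a),Z)>0\}$. *)

(* Defs.v *)
From HB Require Import structures.
From mathcomp Require Import all_boot all_order all_algebra.
From mathcomp Require Import all_classical all_reals all_analysis.
Set Implicit Arguments.
Unset Strict Implicit.
Unset Printing Implicit Defensive.
Import Order.TTheory GRing.Theory Num.Theory.
Import numFieldNormedType.Exports.
Local Open Scope classical_set_scope.
Local Open Scope ring_scope.

(* Points of R^n are row vectors: linear maps act on the right and linear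
   subspaces of R^n are row spaces of matrices (scope %MS). *)

Section Smooth.
Variable R : realType.

(* [f] is C^k on the open set [O]; the values of [f] off [O] are irrelevant. *)
Fixpoint Ck_on (k : nat) m n (O : set 'rV[R]_m) (f : 'rV[R]_m -> 'rV[R]_n) :
    Prop :=
  (forall x, O x -> {for x, continuous f}) /\
  if k is k'.+1 then
    forall v, (forall x, O x -> derivable f x v) /\ Ck_on k' O ('D_v f)
  else True.

Definition smooth_on m n (O : set 'rV[R]_m) (f : 'rV[R]_m -> 'rV[R]_n) : Prop :=
  forall k, Ck_on k O f.

Lemma Ck_on_ext k m n (O : set 'rV[R]_m) (f g : 'rV[R]_m -> 'rV[R]_n) :
  open O -> (forall x, O x -> f x = g x) -> Ck_on k O f -> Ck_on k O g.
Proof.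
move=> oO.
have nfg (p q : 'rV[R]_m -> 'rV[R]_n) x :
    (forall x, O x -> p x = q x) -> O x -> {near x, p =1 q}.
  by move=> pq Ox; near=> y; apply: pq; near: y; exact: open_nbhs_nbhs.
have cg (p q : 'rV[R]_m -> 'rV[R]_n) : (forall x, O x -> p x = q x) ->
    (forall x, O x -> {for x, continuous p}) ->
    forall x, O x -> {for x, continuous q}.
  move=> pq cp x Ox; have pqx := nfg _ _ _ pq Ox.
  rewrite /prop_for /continuous_at -(pq _ Ox).
  by apply: cvg_trans (cp x Ox); apply: near_eq_cvg pqx.
elim: k f g => [|k IH] f g fg /= [cf Df]; split; try exact: cg cf.
  by [].
move=> v; have [dv Dv] := Df v; split=> [x Ox|].
  by apply: near_eq_derivable (dv x Ox); exact: nfg.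
by apply: IH Dv => x Ox; apply: near_eq_derive; exact: nfg.
Unshelve. all: by end_near.
Qed.

Lemma cvg_row_mx (T : Type) (F : set_system T) {FF : Filter F} m n
    (f : T -> 'rV[R]_m) (g : T -> 'rV[R]_n) (a : 'rV[R]_m) (b : 'rV[R]_n) :
  f @ F --> a -> g @ F --> b ->
  (row_mx (f x) (g x) : 'rV[R]_(m + n)) @[x --> F] --> row_mx a b.
Proof.
move=> fa gb; apply/cvg_ballP => e e0.
have /cvg_ballP/(_ e e0) fe := fa; have /cvg_ballP/(_ e e0) ge := gb.
near=> x; split=> // i j.
have [_ fx] : ball a e (f x) by near: x.
have [_ gx] : ball b e (g x) by near: x.
by rewrite !mxE; case: (fintype.split j).
Unshelve. all: by end_near.
Qed.

Lemma Ck_on_row_mx k m1 m2 n1 n2 (O1 : set 'rV[R]_m1) (O2 : set 'rV[R]_m2)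
    (O : set 'rV[R]_(m1 + m2))
    (f : 'rV[R]_m1 -> 'rV[R]_n1) (g : 'rV[R]_m2 -> 'rV[R]_n2) :
  open O -> (forall v, O v -> O1 (lsubmx v) /\ O2 (rsubmx v)) ->
  Ck_on k O1 f -> Ck_on k O2 g ->
  Ck_on k O (fun v => row_mx (f (lsubmx v)) (g (rsubmx v))).
Proof.
move=> oO O12.
have crow (p : 'rV[R]_m1 -> 'rV[R]_n1) (q : 'rV[R]_m2 -> 'rV[R]_n2) :
    (forall x, O1 x -> {for x, continuous p}) ->
    (forall x, O2 x -> {for x, continuous q}) -> forall x, O x ->
    {for x, continuous (fun v => row_mx (p (lsubmx v)) (q (rsubmx v)))}.
  move=> cp cq x /O12[Ox1 Ox2]; apply: (@cvg_row_mx _ (nbhs x)).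
    by apply: (@continuous_comp _ _ _ lsubmx p);
      [exact: continuous_lsubmx|exact: cp].
  by apply: (@continuous_comp _ _ _ rsubmx q);
    [exact: continuous_rsubmx|exact: cq].
elim: k f g => [|k IH] f g /= [cf Df] [cg Dg]; split; try exact: crow.
  by [].
move=> v; have [df Dfv] := Df (lsubmx v); have [dg Dgv] := Dg (rsubmx v).
have D x : O x ->
    h^-1 *: (row_mx (f (lsubmx (h *: v + x))) (g (rsubmx (h *: v + x))) -
             row_mx (f (lsubmx x)) (g (rsubmx x))) @[h --> 0^'] -->
    row_mx ('D_(lsubmx v) f (lsubmx x)) ('D_(rsubmx v) g (rsubmx x)).
  move=> /O12[Ox1 Ox2].
  have lsubmxE h : lsubmx (h *: v + x) = h *: lsubmx v + lsubmx x.
    by rewrite linearD linearZ.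
  have rsubmxE h : rsubmx (h *: v + x) = h *: rsubmx v + rsubmx x.
    by rewrite linearD linearZ.
  under eq_fun do rewrite opp_row_mx add_row_mx scale_row_mx
    lsubmxE rsubmxE.
  by apply: cvg_row_mx; [exact: df|exact: dg].
split=> [x Ox|]; first by apply/cvg_ex; eexists; exact: D Ox.
apply: Ck_on_ext (IH _ _ Dfv Dgv) => // x Ox.
by apply/esym/cvg_lim; [exact: norm_hausdorff|exact: D].
Qed.

(* The homeomorphism [chart_to] from the open set [chart_dom] onto the open set
   [chart_cod], with inverse [chart_from]; both functions are total and carry no
   information off these sets. *)
Record chart (T : topologicalType) (n : nat) := Chart {
  chart_dom : set T;
  chart_cod : set 'rV[R]_n;
  chart_to : T -> 'rV[R]_n;
  chart_from : 'rV[R]_n -> T;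
  chart_dom_open : open chart_dom;
  chart_cod_open : open chart_cod;
  chart_to_cod : forall x, chart_dom x -> chart_cod (chart_to x);
  chart_from_dom : forall v, chart_cod v -> chart_dom (chart_from v);
  chart_toK : forall x, chart_dom x -> chart_from (chart_to x) = x;
  chart_fromK : forall v, chart_cod v -> chart_to (chart_from v) = v;
  chart_to_continuous :
    forall x, chart_dom x -> {for x, continuous chart_to};
  chart_from_continuous :
    forall v, chart_cod v -> {for v, continuous chart_from}
}.

Arguments chart_dom_open {T n} c : rename.
Arguments chart_cod_open {T n} c : rename.

Definition smooth_transition (T : topologicalType) n (c d : chart T n) : Prop :=
  smooth_on (chart_cod c `&` chart_from c @^-1` chart_dom d)
            (chart_to d \o chart_from c).

(* C^oo manifolds of dimension [n], Hausdorff, without boundary and with a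
   countable basis; the family [chart_at] is a smooth atlas which distinguishes
   a chart around each point. *)
Record manifold (n : nat) := Manifold {
  manifold_sort :> topologicalType;
  manifold_hausdorff : hausdorff_space manifold_sort;
  manifold_countable : @second_countable manifold_sort;
  chart_at : manifold_sort -> chart manifold_sort n;
  mem_chart_at : forall x, chart_dom (chart_at x) x;
  chart_at_smooth : forall x y, smooth_transition (chart_at x) (chart_at y)
}.

Section Product.
Variables (m n : nat).

Lemma open_prod (S T : topologicalType) (U : set S) (V : set T) :
  open U -> open V -> open (U `*` V).
Proof.
move=> oU oV; rewrite openE => -[x y] [/= Ux Vy]; exists (U, V) => //=.
by split; exact: open_nbhs_nbhs.
Qed.

Lemma prod_hausdorff (S T : topologicalType) :
  hausdorff_space S -> hausdorff_space T -> hausdorff_space (S * T)%type.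
Proof.
move=> hS hT [p1 p2] [q1 q2] clpq; congr pair.
  apply: (hS p1 q1) => A B pA qB.
  have [[x y] [/= Ax Bx]] : (A `*` [set: T]) `&` (B `*` [set: T]) !=set0.
    by apply: clpq; [exists (A, setT)|exists (B, setT)];
      do ?[by []]; split=> //; exact: filterT.
  by exists x; split; [case: Ax|case: Bx].
apply: (hT p2 q2) => A B pA qB.
have [[x y] [/= Ax Bx]] : ([set: S] `*` A) `&` ([set: S] `*` B) !=set0.
  by apply: clpq; [exists (setT, A)|exists (setT, B)];
    do ?[by []]; split=> //; exact: filterT.
by exists y; split; [case: Ax|case: Bx].
Qed.

Lemma prod_second_countable (S T : topologicalType) :
  @second_countable S -> @second_countable T ->
  @second_countable (S * T)%type.
Proof.
move=> [B cB [oB bB]] [C cC [oC bC]].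
exists ((fun UV => UV.1 `*` UV.2) @` (B `*` C)).
  exact/(sub_countable (card_image_le _ _))/countableX.
split=> [_ [[U V] [/= BU CV] <-]|[x y] W].
  by apply: open_prod; [exact: oB|exact: oC].
move=> [[P Q] [/= xP yQ] PQW].
have [U [BU Ux] UP] := bB x P xP; have [V [CV Vy] VQ] := bC y Q yQ.
exists (U `*` V); first by split; [exists (U, V)|split].
by move=> [u v] [/= Uu Vv]; apply: PQW; split; [exact: UP|exact: VQ].
Qed.

Section Chart.
Variables (S T : topologicalType) (c : chart S m) (d : chart T n).

Let dom : set (S * T) := chart_dom c `*` chart_dom d.
Let cod : set 'rV[R]_(m + n) :=
  lsubmx @^-1` chart_cod c `&` rsubmx @^-1` chart_cod d.
Let to (p : S * T) : 'rV[R]_(m + n) := row_mx (chart_to c p.1) (chart_to d p.2).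
Let from (v : 'rV[R]_(m + n)) : S * T :=
  (chart_from c (lsubmx v), chart_from d (rsubmx v)).

Fact prod_chart_dom_open : open dom.
Proof. by apply: open_prod; exact: chart_dom_open. Qed.

Fact prod_chart_cod_open : open cod.
Proof.
have cl : continuous (lsubmx : 'rV[R]_(m + n) -> 'rV[R]_m).
  exact: continuous_lsubmx.
have cr : continuous (rsubmx : 'rV[R]_(m + n) -> 'rV[R]_n).
  exact: continuous_rsubmx.
apply: openI; first exact: ((continuousP _).1 cl _ (chart_cod_open c)).
exact: ((continuousP _).1 cr _ (chart_cod_open d)).
Qed.

Fact prod_chart_to_cod p : dom p -> cod (to p).
Proof.
by move=> [cp dp]; rewrite /cod/= row_mxKl row_mxKr; split;
  exact: chart_to_cod.
Qed.

Fact prod_chart_from_dom v : cod v -> dom (from v).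
Proof. by move=> [cv dv]; split; exact: chart_from_dom. Qed.

Fact prod_chart_toK p : dom p -> from (to p) = p.
Proof.
by case: p => x y [/= cx dy]; rewrite /from row_mxKl row_mxKr !chart_toK.
Qed.

Fact prod_chart_fromK v : cod v -> to (from v) = v.
Proof. by move=> [cv dv]; rewrite /to /= !chart_fromK// hsubmxK. Qed.

Fact prod_chart_to_continuous p : dom p -> {for p, continuous to}.
Proof.
move=> [cp dp]; apply: (@cvg_row_mx _ (nbhs p)).
  by apply: (@continuous_comp _ _ _ fst (chart_to c));
    [exact: cvg_fst|exact: chart_to_continuous].
by apply: (@continuous_comp _ _ _ snd (chart_to d));
  [exact: cvg_snd|exact: chart_to_continuous].
Qed.

Fact prod_chart_from_continuous v : cod v -> {for v, continuous from}.
Proof.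
move=> [cv dv].
have cf : {for v, continuous (chart_from c \o lsubmx)}.
  by apply: continuous_comp;
    [exact: continuous_lsubmx|exact: chart_from_continuous].
have df : {for v, continuous (chart_from d \o rsubmx)}.
  by apply: continuous_comp;
    [exact: continuous_rsubmx|exact: chart_from_continuous].
exact: cvg_pair cf df.
Qed.

Definition prod_chart : chart (S * T)%type (m + n) :=
  @Chart _ _ dom cod to from prod_chart_dom_open prod_chart_cod_open
    prod_chart_to_cod prod_chart_from_dom prod_chart_toK prod_chart_fromK
    prod_chart_to_continuous prod_chart_from_continuous.

End Chart.

Lemma transition_open (T : topologicalType) k (c d : chart T k) :
  open (chart_cod c `&` chart_from c @^-1` chart_dom d).
Proof.
rewrite openE => v [cv dv].
have nc : nbhs v (chart_cod c).
  exact: open_nbhs_nbhs (conj (chart_cod_open c) cv).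
have nd : nbhs (chart_from c v) (chart_dom d).
  exact: open_nbhs_nbhs (conj (chart_dom_open d) dv).
exact: filterI nc (chart_from_continuous cv nd).
Qed.

Variables (X : manifold m) (Y : manifold n).

Fact prod_manifold_smooth (p q : X * Y) :
  smooth_transition (prod_chart (chart_at p.1) (chart_at p.2))
                    (prod_chart (chart_at q.1) (chart_at q.2)).
Proof.
move=> k.
set O := (O in Ck_on _ O _).
have oO : open O by exact: transition_open.
refine (Ck_on_row_mx oO _
  (chart_at_smooth p.1 q.1 k) (chart_at_smooth p.2 q.2 k)).
by move=> v [[c1 c2] [d1 d2]].
Qed.

Definition prod_manifold : manifold (m + n) :=
  @Manifold (m + n) (X * Y)%type
    (prod_hausdorff (@manifold_hausdorff _ X) (@manifold_hausdorff _ Y))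
    (prod_second_countable
       (@manifold_countable _ X) (@manifold_countable _ Y))
    (fun p => prod_chart (chart_at p.1) (chart_at p.2))
    (fun p => conj (mem_chart_at p.1) (mem_chart_at p.2))
    prod_manifold_smooth.

End Product.
End Smooth.

Section Submanifold.
Variables (R : realType) (n : nat) (Y : manifold R n).

(* Embedded C^oo submanifolds of [Y], not necessarily closed: [slice_at z] is a
   smooth chart of [Y] around [z \in Z] in which [Z] is the set of the points
   whose coordinates of index at least [sub_dim] vanish. *)
Record submanifold := Submanifold {
  sub_dim : nat;
  sub_set : set Y;
  slice_at : Y -> chart R Y n;
  sub_dim_le : (sub_dim <= n)%N;
  mem_slice_at : forall z, sub_set z -> chart_dom (slice_at z) z;
  slice_at_smooth : forall z y, sub_set z ->
    smooth_transition (slice_at z) (chart_at y) /\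
    smooth_transition (chart_at y) (slice_at z);
  slice_atP : forall z y, sub_set z -> chart_dom (slice_at z) y ->
    sub_set y <-> forall i : 'I_n, (sub_dim <= i)%N ->
                    chart_to (slice_at z) y 0 i = 0
}.

(* T_z Z as a subspace of T_z Y, the latter being identified with R^n by the
   chart [chart_at z]: the image of R^sub_dim x 0 under the derivative of the
   change of coordinates from [slice_at z] to [chart_at z]. *)
Definition sub_tangent (Z : submanifold) (z : Y) : 'M[R]_n :=
  pid_mx (sub_dim Z) *m
  jacobian (chart_to (chart_at z) \o chart_from (slice_at Z z))
           (chart_to (slice_at Z z) z).

End Submanifold.

(* Mappings defined on an open subset [D] of a manifold [X] are functions on the
   subtype [D]; tangent spaces of [D] are those of [X]. *)
Section Transversality.
Variables (R : realType) (m n : nat) (X : manifold R m) (Y : manifold R n).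
Variables (D : set X) (f : D -> Y).

Definition local_rep (c : chart R X m) (d : chart R Y n) (v : 'rV[R]_m) :
    'rV[R]_n :=
  if insub (chart_from c v) is Some x then chart_to d (f x) else 0.

Definition smooth_map : Prop :=
  continuous f /\
  forall (x : X) (y : Y),
    let c := chart_at x in let d := chart_at y in
    smooth_on
      (chart_cod c `&`
       [set v | exists2 x' : D, val x' = chart_from c v & chart_dom d (f x')])
      (local_rep c d).

(* The matrix of df_x : T_x X -> T_(f x) Y in the charts [chart_at]. *)
Definition differential (x : D) : 'M[R]_(m, n) :=
  jacobian (local_rep (chart_at (val x)) (chart_at (f x)))
           (chart_to (chart_at (val x)) (val x)).

Variable Z : submanifold Y.

Definition transverse_at (x : D) : Prop :=
  ~ sub_set Z (f x) \/
  sub_set Z (f x) /\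
    (differential x + sub_tangent Z (f x) :=: (1%:M : 'M[R]_n))%MS.

Definition transverse : Prop := forall x : D, transverse_at x.

Definition delta (x : D) : nat :=
  if f x \in sub_set Z
  then (n - \rank (differential x + sub_tangent Z (f x))%MS)%N
  else 0%N.

End Transversality.

Section MeasureZero.
Variables (R : realType) (n : nat).

Definition box (a b : 'rV[R]_n) : set 'rV[R]_n :=
  [set v | forall i, a 0 i <= v 0 i <= b 0 i].

(* Lebesgue outer measure zero in R^n. The covering families are indexed by
   subsets of nat because a box of R^0 has volume 1. *)
Definition lebesgue_null (S : set 'rV[R]_n) : Prop :=
  forall e : R, 0 < e ->
  exists (K : set nat) (a b : nat -> 'rV[R]_n),
    [/\ forall k i, a k 0 i <= b k 0 i,
        S `<=` \bigcup_(k in K) box (a k) (b k) &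
        (\esum_(k in K) (\prod_(i < n) (b k 0 i - a k 0 i))%:E <= e%:E)%E].

(* [S] is a subset of measure zero of the open subset [O] of the manifold [A]. *)
Definition measure_zero_in (A : manifold R n) (O S : set A) : Prop :=
  S `<=` O /\
  forall a : A,
    lebesgue_null (chart_to (chart_at a) @` (chart_dom (chart_at a) `&` S)).

End MeasureZero.

Section GenericTransversality.
Variables (R : realType) (m p n : nat).
Variables (X : manifold R m) (A : manifold R p) (Y : manifold R n).
Variables (U : set (prod_manifold X A)) (F : U -> Y) (Z : submanifold Y).

(* F_a; its domain [ysection U a] is the projection to X of U `&` (X x {a}). *)
Definition slice_map (a : A) (x : ysection U a) : Y :=
  F (exist _ (val x, a) (etrans (esym (mem_ysection _ _ _)) (valP x))).

Definition generically_transverse : Prop :=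
  exists Sigma : set A, measure_zero_in (snd @` U) Sigma /\
    forall a, (snd @` U `\` Sigma) a -> transverse (@slice_map a) Z.

Definition degenerate_set : set (prod_manifold X A) :=
  [set q | exists (u : U) (x : ysection U q.2),
    [/\ val u = q, val x = q.1,
        delta (@slice_map q.2) Z x = delta F Z u &
        (0 < delta F Z u)%N]].

End GenericTransversality.

(* Main.v *)
From HB Require Import structures.
Require Import Defs.
From mathcomp Require Import all_boot all_order all_algebra.
From mathcomp Require Import all_classical all_reals all_analysis.
From mathcomp Require Import ring lra.
Set Implicit Arguments.
Unset Strict Implicit.
Unset Printing Implicit Defensive.
Import Order.TTheory GRing.Theory Num.Theory.
Import numFieldNormedType.Exports.
Local Open Scope classical_set_scope.
Local Open Scope ring_scope.

(** One direction is immediate. If [F_a] is transverse to [Z] for all [a] outside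
    [Sigma], then [delta (F_a)] vanishes there, so that [Sigma] contains the
    projection of [W(F, Z)].

    For the other one, let [a] be a parameter such that [F_a] is not transverse to
    [Z] at some [x]. If [delta (F_a, x, Z) = delta (F, (x, a), Z)], then [a] is in
    the projection of [W(F, Z)], a null set by hypothesis. Otherwise the two
    quantities differ. In a slice chart of [Z], they are the coranks of the
    derivatives of the transverse coordinates [G] of [F], along [X] and along
    [X * A] respectively ([delta_fibre], [delta_total]). So the rank drops along
    the fibre. Select coordinates of [G] whose differentials at [(x, a)] form a
    basis of the span of all of them. They cut out a level set through [(x, a)],
    and the projection to the parameter is critical on it at [(x, a)]
    ([null_rank_drop]). By Sard's theorem these parameters form a null set.

    Sard's theorem is proved here in the form needed, for a smooth map [f]
    restricted to a level set [G = 0] at its regular points ([sard]). The proof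
    is Milnor's, by induction on the dimension of the level set, but
    equations are added to [G] instead of straightening the level set:
    - if some component [f_j] has a nonzero derivative along the level set, the
      critical values are cut into slices [f_j = t], which are null by induction,
      and a Fubini argument for compact sets concludes ([null_crit_transversal]);
    - if an iterated tangential derivative of the first component vanishes but one
      of its own derivatives does not, it is added to the equations
      ([null_crit_nonflat]);
    - if all tangential derivatives of the first component [phi] vanish up to
      order [N], the dimension of the ambient space, then the differences of
      [phi] are [O(d ^ N.+1)] at distance [d], and counting small cubes shows that
      the image is null ([null_crit_tangential]).

    The last estimate needs paths in the level set. Instead of the implicit
    function theorem it uses a Lipschitz retraction onto the level set, obtained as
    a fixed point ([level_set_retraction]), and finite chains of retracted points
    ([flat_estimate]). *)

(** * Row vectors and linear forms *)

Section RowVectors.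
Variable R : realType.

Lemma ler_coord_norm m n (v : 'M[R]_(m, n)) i j : `|v i j| <= `|v|.
Proof. by rewrite [leRHS]mx_normrE; exact: (le_bigmax _ _ (i, j)). Qed.

Lemma mx_norm_le m n (v : 'M[R]_(m, n)) e :
  0 <= e -> (forall i j, `|v i j| <= e) -> `|v| <= e.
Proof.
by move=> e0 ve; rewrite [leLHS]mx_normrE; apply/bigmax_leP; split=> // -[].
Qed.

Lemma rV_norm_le n (v : 'rV[R]_n) e :
  0 <= e -> (forall j, `|v 0 j| <= e) -> `|v| <= e.
Proof. by move=> e0 ve; apply: mx_norm_le => // i j; rewrite ord1. Qed.

Lemma cvg_rV (T : Type) (F : set_system T) {FF : Filter F} n
    (f : T -> 'rV[R]_n) (a : 'rV[R]_n) :
  (forall j, f x 0 j @[x --> F] --> a 0 j) -> f @ F --> a.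
Proof.
move=> fa; apply/cvgrPdist_le => e e0.
have : \forall x \near F, forall j : 'I_n, `|a 0 j - f x 0 j| <= e.
  by apply: filter_forall => k; have /cvgrPdist_le := fa k; apply.
by apply: filterS => x fx; apply: rV_norm_le (ltW e0) _ => j; rewrite !mxE.
Qed.

Definition rV_form n (c : 'I_n -> R) (h : 'rV[R]_n) : R := \sum_i h 0 i * c i.

Fact rV_form_is_linear n (c : 'I_n -> R) : linear (rV_form c).
Proof.
move=> a u v; rewrite /rV_form /= scaler_sumr -big_split /=.
by apply: eq_bigr => i _; rewrite !mxE mulrDl -mulrA.
Qed.

HB.instance Definition _ n (c : 'I_n -> R) :=
  GRing.isLinear.Build R 'rV[R]_n R _ (rV_form c) (@rV_form_is_linear n c).

Lemma rV_form_continuous n (c : 'I_n -> R) : continuous (rV_form c).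
Proof.
apply: (@continuous_big _ _ _ _ _ add_continuous) => i _ x.
by apply: (@cvgMr_tmp _ _ (nbhs x) _); exact: coord_continuous.
Qed.

Lemma linear_rV_form n (L : {linear 'rV[R]_n -> R}) h :
  L h = rV_form (fun i => L (delta_mx 0 i)) h.
Proof.
rewrite {1}(row_sum_delta h) linear_sum /=.
by apply: eq_bigr => i _; rewrite linearZ.
Qed.

End RowVectors.

(** * Differentiability from directional derivatives *)

Section Differentiability.
Variable R : realType.

(** ['d f x] is picked among the continuous linear maps that approximate [f] to
    first order at [x]; such a map is unique, so exhibiting one is enough. *)
Lemma differentiable_of_o (V W : normedModType R) (f : V -> W)
    (df : {linear V -> W}) (x : V) :
  continuous df ->
  (forall e, 0 < e ->
    \forall h \near 0, `|f (h + x) - f x - df h| <= e * `|h|) ->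
  differentiable f x /\ forall h, 'd f x h = df h.
Proof.
move=> cdf H.
have o : f \o shift x = cst (f x) + df +o_ 0 id.
  apply/eqaddoP => e e0; apply: filterS (H e e0) => h /=.
  by rewrite -![(_ - _ : _ -> _) _]/(_ - _) -![(_ + _ : _ -> _) _]/(_ + _) opprD addrA.
have E := diff_unique cdf o.
by split=> [|h]; [apply/diff_locallyP; rewrite E|rewrite E].
Qed.

Lemma near_eq_diff (V W : normedModType R) (f g : V -> W) (x : V) :
  {near x, f =1 g} -> differentiable f x -> differentiable g x.
Proof.
move=> fg df.
apply: (proj1 (@differentiable_of_o V W g ('d f x) x _ _)).
  exact: diff_continuous.
move=> e e0; have /diff_locally/eqaddoP/(_ e e0) := df.
have : \forall h \near 0, f (h + x) = g (h + x).
  move: fg; rewrite (near_shift 0) /=; apply: filterS => h /=.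
  by rewrite subr0.
apply: filterS2 => h /= <-; rewrite -(nbhs_singleton fg).
by rewrite -![(_ - _ : _ -> _) _]/(_ - _) -![(_ + _ : _ -> _) _]/(_ + _) opprD addrA.
Qed.

Lemma differentiable_rV (V : normedModType R) n (f : V -> 'rV[R]_n) x :
  (forall j, differentiable (fun y => f y 0 j) x) -> differentiable f x.
Proof.
move=> df.
have -> : f = \sum_(j < n) (fun y => f y 0 j *: delta_mx 0 j).
  apply/funext => y; rewrite fct_sumE; exact: row_sum_delta.
by apply: differentiable_sum => j; exact: differentiableZl.
Qed.

Lemma mvt_segment (V : normedModType R) (phi : V -> R) a v :
  (forall t : R, 0 <= t <= 1 -> derivable phi (t *: v + a) v) ->
  exists2 t : R, 0 <= t <= 1 & phi (v + a) - phi a = 'D_v phi (t *: v + a).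
Proof.
move=> dphi; pose g (t : R) := phi (t *: v + a).
have dg (t : R) : 0 <= t <= 1 -> is_derive t 1 g ('D_v phi (t *: v + a)).
  move=> t01; have d := dphi t t01.
  have E : (fun h : R => h^-1 *: ((g \o shift t) (h *: 1) - g t)) =
      (fun h => h^-1 *: ((phi \o shift (t *: v + a)) (h *: v) - phi (t *: v + a))).
    by apply/funext => h /=; rewrite /g [h *: 1]mulr1 scalerDl addrA.
  by split; rewrite /derivable /derive E.
have [||t] := @MVT_segment R g (fun t => 'D_v phi (t *: v + a)) 0 1 ler01.
- by move=> t; rewrite in_itv /= => /andP[t0 t1]; apply: dg; rewrite !ltW.
- apply: derivable_within_continuous => t; rewrite in_itv /= => t01.
  by have [] := dg t t01.
rewrite in_itv /= => t01; rewrite /g scale1r scale0r add0r subr0 mulr1 => E.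
by exists t.
Qed.

End Differentiability.

Section Smooth.
Variable R : realType.

Lemma derivable_dirZ (V W : normedModType R) (f : V -> W) x v (a : R) :
  derivable f x v ->
  derivable f x (a *: v) /\ 'D_(a *: v) f x = a *: 'D_v f x.
Proof.
move=> dv; pose g (h : R) := f (h *: v + x).
have dg : differentiable g 0.
  by apply: (derivable1_diffP _ _).1; exact: (derivable1P _ _ _).1 dv.
have E w : 'D_w f x = 'D_1 (fun h : R => f (h *: w + x)) 0.
  rewrite /derive; set g1 := (fun h : R => h^-1 *: ((f \o shift x) (h *: w) - f x)).
  set g2 := (fun h : R => h^-1 *: 
    (((fun h : R => f (h *: w + x)) \o shift 0) (h *: 1) - f (0 *: w + x))).
  suff -> : g1 = g2 by []; apply/funext => h; rewrite /g1 /g2 /=.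
  by rewrite addr0 scale0r add0r [_%:A]mulr1.
have dl : differentiable (fun h : R => h * a) 0.
  by apply/derivable1_diffP; apply: (@derivableM _ _ id (cst a)).
have gE : (fun h : R => f (h *: (a *: v) + x)) = g \o (fun h => h * a).
  by apply/funext => h /=; rewrite /g scalerA.
have dga : differentiable (g \o (fun h => h * a)) 0.
  by apply: differentiable_comp => //; rewrite mul0r.
split; first by apply/derivable1P; rewrite gE; exact/derivable1_diffP.
rewrite E gE deriveE // diff_comp //=; last by rewrite mul0r.
rewrite mul0r -(deriveE _ dl) E -(deriveE _ dg).
suff -> : 'D_1 (fun h : R => h * a) 0 = a *: (1 : R).
  by rewrite (deriveE _ dg) linearZ -deriveE.
by rewrite deriveMr ?derive_id// [_ *: 1]mulr1 [RHS]mulr1.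
Qed.

(** The increment is split along the path which changes the coordinates one at
    a time. The mean value theorem turns each step into a partial derivative at
    a point close to [x], and these are continuous. *)
Lemma C1_differentiable m (phi : 'rV[R]_m -> R) (x : 'rV[R]_m) :
  (\forall y \near x, forall i, derivable phi y (delta_mx 0 i)) ->
  (forall i, {for x, continuous ('D_(delta_mx 0 i) phi)}) ->
  differentiable phi x.
Proof.
move=> dphi cphi; pose c i := 'D_(delta_mx 0 i) phi x.
apply: (proj1 (@differentiable_of_o R _ _ phi (rV_form c) x _ _)).
  exact: rV_form_continuous.
move=> e e0; pose e' := e / m.+1%:R.
have e'0 : 0 < e' by rewrite divr_gt0.
have cphi' : \forall y \near x, forall i,
    `|'D_(delta_mx 0 i) phi x - 'D_(delta_mx 0 i) phi y| <= e'.
  apply: (@filter_forall _ _ _ (nbhs x)) => i.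
  by have /cvgrPdist_le := cphi i; apply.
have [r /= r0 Hr] := (nbhs_ballP _ _).1 (filterI dphi cphi').
apply/nbhs_ballP; exists r => //= h; rewrite -ball_normE /= sub0r normrN => hr.
have {}Hr (y : 'rV[R]_m) : `|y| <= `|h| ->
    (forall i, derivable phi (y + x) (delta_mx 0 i)) /\
    forall i, `|c i - 'D_(delta_mx 0 i) phi (y + x)| <= e'.
  move=> yh; apply: Hr; rewrite -ball_normE /= opprD addrCA subrr addr0 normrN.
  exact: le_lt_trans hr.
(* The coordinates of index less than [k] have been changed. *)
pose hk k : 'rV[R]_m := \row_i (if (i < k)%N then h 0 i else 0).
have hkh k (t : R) (i : 'I_m) : 0 <= t <= 1 -> val i = k ->
    `|t *: (h 0 i *: delta_mx 0 i) + hk k| <= `|h|.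
  move=> /andP[t0 t1] ik; apply: rV_norm_le => // j; rewrite !mxE eqxx /=.
  have [->|ji] := eqVneq j i.
    rewrite ik ltnn addr0 mulr1 normrM ger0_norm//.
    by rewrite (le_trans (ler_piMl _ t1)) ?ler_coord_norm.
  rewrite !mulr0 add0r; case: ifP => _; first exact: ler_coord_norm.
  by rewrite normr0.
have step (i : 'I_m) :
    `|phi (hk i.+1 + x) - phi (hk i + x) - h 0 i * c i| <= e' * `|h|.
  have E : hk i.+1 = h 0 i *: delta_mx 0 i + hk i.
    apply/rowP => j; rewrite !mxE eqxx /= ltnS leq_eqVlt.
    have [->|ji] := eqVneq j i; first by rewrite eqxx ltnn mulr1 addr0.
    by rewrite -(inj_eq val_inj) in ji; rewrite (negPf ji) mulr0 add0r.
  have dv (t : R) : 0 <= t <= 1 -> derivable phi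
      (t *: (h 0 i *: delta_mx 0 i) + (hk i + x)) (delta_mx 0 i).
    by move=> t01; rewrite addrA; apply: (Hr _ _).1; exact: hkh.
  have [|t t01] := @mvt_segment R _ phi (hk i + x) (h 0 i *: delta_mx 0 i).
    by move=> t t01; apply: (derivable_dirZ _ (dv t t01)).1.
  rewrite E addrA => ->; rewrite (derivable_dirZ _ (dv t t01)).2.
  rewrite -[_ *: _]/(_ * _) -mulrBr normrM mulrC addrA distrC.
  apply: ler_pM => //; last exact: ler_coord_norm.
  by apply: (Hr _ _).2; exact: hkh.
have -> : phi (h + x) - phi x - rV_form c h =
    \sum_(i < m) (phi (hk i.+1 + x) - phi (hk i + x) - h 0 i * c i).
  rewrite sumrB /=; congr (_ - _).
  rewrite -(big_mkord xpredT (fun k => phi (hk k.+1 + x) - phi (hk k + x))).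
  rewrite (@telescope_sumr _ 0 m (fun k => phi (hk k + x))) //.
  have -> : hk m = h by apply/rowP => j; rewrite mxE ltn_ord.
  suff -> : hk 0%N = 0 by rewrite add0r.
  by apply/rowP => j; rewrite !mxE.
apply: le_trans (ler_norm_sum _ _ _) _.
apply: le_trans (ler_sum _ (fun i _ => step i)) _.
rewrite sumr_const card_ord -[X in X <= _]mulr_natr mulrAC ler_wpM2r//.
rewrite /e' mulrAC ler_pdivrMr ?ltr0n// ler_wpM2l ?(ltW e0)// ler_nat.
exact: leqnSn.
Qed.

End Smooth.

(** * Smooth functions *)

Lemma near_eq_continuous (T U : topologicalType) (f g : T -> U) x :
  {near x, f =1 g} -> {for x, continuous f} -> {for x, continuous g}.
Proof.
move=> fg cf; rewrite /prop_for /continuous_at -(nbhs_singleton fg).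
apply: cvg_trans cf; apply: near_eq_cvg.
by apply: filterS fg => y ->.
Qed.

Section SmoothFunctions.
Variables (R : realType) (m : nat).
Implicit Types (O : set 'rV[R]_m) (phi psi : 'rV[R]_m -> R).

(** Each order asks for differentiability, which makes the product rule and the
    chain rule immediate; one order of [Ck_on] pays for it ([Ck_on_coord]). *)
Fixpoint Ck k O phi : Prop :=
  (forall x, O x -> differentiable phi x) /\
  if k is k'.+1 then forall v, Ck k' O ('D_v phi) else True.

Definition smooth O phi := forall k, Ck k O phi.

Lemma Ck_differentiable k O phi x : Ck k O phi -> O x -> differentiable phi x.
Proof. by case: k => [|k] /= [d _]; apply: d. Qed.

Lemma smooth_differentiable O phi x :
  smooth O phi -> O x -> differentiable phi x.
Proof. by move=> /(_ 0%N) /Ck_differentiable; apply. Qed.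

Lemma smooth_derive O phi v : smooth O phi -> smooth O ('D_v phi).
Proof. by move=> s k; have /= [_] := s k.+1; apply. Qed.

Lemma Ck_ext k O phi psi :
  open O -> (forall x, O x -> phi x = psi x) -> Ck k O phi -> Ck k O psi.
Proof.
move=> oO; elim: k phi psi => [|k IH] phi psi E /= [d D].
all: have nE x : O x -> {near x, phi =1 psi} by
  move=> Ox; apply: filterS E _; exact: open_nbhs_nbhs.
all: split=> [x Ox|]; first by apply: near_eq_diff (nE x Ox) (d x Ox).
  by [].
by move=> v; apply: IH (D v) => x Ox; apply: near_eq_derive; exact: nE.
Qed.

Lemma Ck_sub k O O' phi : O' `<=` O -> Ck k O phi -> Ck k O' phi.
Proof.
move=> OO; elim: k phi => [|k IH] phi /= [d D]; split; do ?by move=> x /OO /d.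
  by [].
by move=> v; exact: IH.
Qed.

Lemma CkW k O phi : Ck k.+1 O phi -> Ck k O phi.
Proof.
by elim: k phi => [|k IH] phi [d D]; split=> // v; apply: IH; exact: D.
Qed.

Lemma Ck_cst k O (c : R) : Ck k O (cst c).
Proof.
elim: k c => [|k IH] c /=; split=> // v.
suff -> : 'D_v (cst c : 'rV[R]_m -> R) = cst 0 by exact: IH.
by apply/funext => x; rewrite derive_cst.
Qed.

Lemma Ck_rV_form k O (c : 'I_m -> R) : Ck k O (rV_form c).
Proof.
have d x : differentiable (rV_form c) x.
  by apply: linear_differentiable; exact: rV_form_continuous.
case: k => [|k] /=; split=> // v.
rewrite (_ : 'D_v _ = cst (rV_form c v)); first exact: Ck_cst.
by apply/funext => x; rewrite deriveE // diff_lin //; exact: rV_form_continuous.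
Qed.

Lemma CkD k O phi psi : open O ->
  Ck k O phi -> Ck k O psi -> Ck k O (fun x => phi x + psi x).
Proof.
move=> oO; elim: k phi psi => [|k IH] phi psi /= [d D] [e E]; split=> //.
- by move=> x Ox; apply: differentiableD; [exact: d|exact: e].
- by move=> x Ox; apply: differentiableD; [exact: d|exact: e].
move=> v; apply: Ck_ext (IH _ _ (D v) (E v)) => // x Ox.
by rewrite deriveD //; apply: diff_derivable; [exact: d|exact: e].
Qed.

Lemma CkM k O phi psi : open O ->
  Ck k O phi -> Ck k O psi -> Ck k O (fun x => phi x * psi x).
Proof.
move=> oO; elim: k phi psi => [|k IH] phi psi s t.
  by split=> // x Ox; apply: differentiableM;
    [exact: Ck_differentiable s Ox|exact: Ck_differentiable t Ox].
have [d D] := s; have [e E] := t.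
split=> [x Ox|v]; first by apply: differentiableM; [exact: d|exact: e].
apply: Ck_ext (CkD oO (IH _ _ (CkW s) (E v)) (IH _ _ (CkW t) (D v))) => // x Ox.
by rewrite deriveM //; apply: diff_derivable; [exact: d|exact: e].
Qed.

Section Ring.
Variables (O : set 'rV[R]_m) (oO : open O).

Lemma smooth_ext phi psi :
  (forall x, O x -> phi x = psi x) -> smooth O phi -> smooth O psi.
Proof. by move=> E s k; exact: Ck_ext E (s k). Qed.

Lemma smooth_cst (c : R) : smooth O (fun=> c).
Proof. by move=> k; exact: Ck_cst. Qed.

Lemma smooth_coord i : smooth O (fun x => x 0 i).
Proof.
move=> k; rewrite (_ : (fun _ => _) = rV_form (fun j => (j == i)%:R)).
  exact: Ck_rV_form.
apply/funext => x; rewrite /rV_form (bigD1 i) //= eqxx mulr1 big1 ?addr0// => j.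
by move=> /negPf ->; rewrite mulr0.
Qed.

Lemma smoothD phi psi :
  smooth O phi -> smooth O psi -> smooth O (fun x => phi x + psi x).
Proof. by move=> s t k; apply: CkD. Qed.

Lemma smoothM phi psi :
  smooth O phi -> smooth O psi -> smooth O (fun x => phi x * psi x).
Proof. by move=> s t k; apply: CkM. Qed.

Lemma smoothN phi : smooth O phi -> smooth O (fun x => - phi x).
Proof.
move=> s; apply: smooth_ext (smoothM (smooth_cst (-1)) s) => x _.
by rewrite mulN1r.
Qed.

Lemma smoothB phi psi :
  smooth O phi -> smooth O psi -> smooth O (fun x => phi x - psi x).
Proof. by move=> s t; apply: smoothD => //; exact: smoothN. Qed.

Lemma smooth_sum (I : Type) (r : seq I) (P : pred I) (F : I -> 'rV[R]_m -> R) :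
  (forall i, P i -> smooth O (F i)) -> smooth O (fun x => \sum_(i <- r | P i) F i x).
Proof.
move=> sF; elim: r => [|i r IH].
  by apply: smooth_ext (smooth_cst 0) => x _; rewrite big_nil.
have [Pi|nPi] := boolP (P i).
  by apply: smooth_ext (smoothD (sF _ Pi) IH) => x _; rewrite big_cons Pi.
by apply: smooth_ext IH => x _; rewrite big_cons (negPf nPi).
Qed.

Lemma smooth_prod (I : Type) (r : seq I) (P : pred I) (F : I -> 'rV[R]_m -> R) :
  (forall i, P i -> smooth O (F i)) -> smooth O (fun x => \prod_(i <- r | P i) F i x).
Proof.
move=> sF; elim: r => [|i r IH].
  by apply: smooth_ext (smooth_cst 1) => x _; rewrite big_nil.
have [Pi|nPi] := boolP (P i).
  by apply: smooth_ext (smoothM (sF _ Pi) IH) => x _; rewrite big_cons Pi.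
by apply: smooth_ext IH => x _; rewrite big_cons (negPf nPi).
Qed.

Definition smooth_mx a b (M : 'rV[R]_m -> 'M[R]_(a, b)) :=
  forall i j, smooth O (fun x => M x i j).

Lemma smooth_mulmx a b c (M : 'rV[R]_m -> 'M[R]_(a, b)) (N : 'rV[R]_m -> 'M[R]_(b, c)) :
  smooth_mx M -> smooth_mx N -> smooth_mx (fun x => M x *m N x).
Proof.
move=> sM sN i j.
apply: (@smooth_ext (fun x => \sum_k M x i k * N x k j)) => [x _|].
  by rewrite mxE.
by apply: smooth_sum => k _; exact: smoothM.
Qed.

Lemma smooth_mx_cst a b (M : 'M[R]_(a, b)) : smooth_mx (fun=> M).
Proof. by move=> i j; exact: smooth_cst. Qed.

Lemma smooth_mxB a b (M N : 'rV[R]_m -> 'M[R]_(a, b)) :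
  smooth_mx M -> smooth_mx N -> smooth_mx (fun x => M x - N x).
Proof.
move=> sM sN i j; apply: smooth_ext (smoothB (sM i j) (sN i j)) => x _.
by rewrite !mxE.
Qed.

Lemma smooth_mxZ a b phi (M : 'rV[R]_m -> 'M[R]_(a, b)) :
  smooth O phi -> smooth_mx M -> smooth_mx (fun x => phi x *: M x).
Proof.
move=> sp sM i j; apply: smooth_ext (smoothM sp (sM i j)) => x _.
by rewrite !mxE.
Qed.

Lemma smooth_det a (M : 'rV[R]_m -> 'M[R]_a) :
  smooth_mx M -> smooth O (fun x => \det (M x)).
Proof.
move=> sM; apply: smooth_sum => s _; apply: smoothM; first exact: smooth_cst.
by apply: smooth_prod => i _; exact: sM.
Qed.

Lemma smooth_adj a (M : 'rV[R]_m -> 'M[R]_a) :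
  smooth_mx M -> smooth_mx (fun x => \adj (M x)).
Proof.
move=> sM i j; apply: (@smooth_ext (fun x => cofactor (M x) j i)) => [x _|].
  by rewrite mxE.
apply: smoothM; first exact: smooth_cst.
apply: smooth_det => k l.
by apply: smooth_ext (sM (lift j k) (lift i l)) => x _; rewrite !mxE.
Qed.

End Ring.

Lemma smooth_continuous O phi x : smooth O phi -> O x -> {for x, continuous phi}.
Proof. by move=> s Ox; exact/differentiable_continuous/(smooth_differentiable s). Qed.

Lemma smooth_sub O O' phi : O' `<=` O -> smooth O phi -> smooth O' phi.
Proof. by move=> OO s k; exact: Ck_sub (s k). Qed.

End SmoothFunctions.

(** * Gradients, Jacobian matrices and the chain rule *)

Section Gradient.
Variable R : realType.

Definition grad m (phi : 'rV[R]_m -> R) x : 'cV[R]_m :=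
  \col_i 'D_(delta_mx 0 i) phi x.

Definition Jac m n (G : 'rV[R]_m -> 'rV[R]_n) x : 'M[R]_(m, n) :=
  \matrix_(i, j) 'D_(delta_mx 0 i) (fun y => G y 0 j) x.

Lemma derive_grad m (phi : 'rV[R]_m -> R) x v :
  differentiable phi x -> 'D_v phi x = (v *m grad phi x) 0 0.
Proof.
move=> d; rewrite deriveE // linear_rV_form /rV_form mxE.
by apply: eq_bigr => i _; rewrite mxE deriveE.
Qed.

Lemma col_Jac m n (G : 'rV[R]_m -> 'rV[R]_n) x j :
  col j (Jac G x) = grad (fun y => G y 0 j) x.
Proof. by apply/colP => i; rewrite !mxE. Qed.

Lemma smooth_grad m (O : set 'rV[R]_m) phi :
  open O -> smooth O phi -> smooth_mx O (grad phi).
Proof.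
move=> oO s i j; apply: smooth_ext (smooth_derive (delta_mx 0 i) s) => // x _.
by rewrite mxE.
Qed.

Lemma smooth_Jac m n (O : set 'rV[R]_m) (G : 'rV[R]_m -> 'rV[R]_n) :
  open O -> smooth_mx O G -> smooth_mx O (Jac G).
Proof.
move=> oO s i j; apply: smooth_ext (smooth_derive (delta_mx 0 i) (s 0 j)) => // x _.
by rewrite mxE.
Qed.

Lemma smooth_mx_differentiable m n (O : set 'rV[R]_m) (G : 'rV[R]_m -> 'rV[R]_n) x :
  smooth_mx O G -> O x -> differentiable G x.
Proof.
by move=> s Ox; apply: differentiable_rV => j; exact: smooth_differentiable (s 0 j) Ox.
Qed.

Lemma coord_derive m n (G : 'rV[R]_m -> 'rV[R]_n) x v j : derivable G x v ->
  'D_v G x 0 j = 'D_v (fun y => G y 0 j) x.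
Proof. by move=> d; rewrite derive_mx // mxE. Qed.

Lemma jacobian_Jac m n (G : 'rV[R]_m -> 'rV[R]_n) x :
  differentiable G x -> jacobian G x = Jac G x.
Proof.
move=> d; apply/matrixP => i j.
rewrite [RHS]mxE -coord_derive; last exact: diff_derivable.
by rewrite deriveEjacobian // -rowE [RHS]mxE.
Qed.

(** ['D_v (phi \o h)] is a sum of products of a derivative of [h] and some
    ['D_(delta_mx 0 j) phi \o h], so the induction is on the order, for all
    [phi] at once. *)
Lemma Ck_comp k m n (O : set 'rV[R]_m) (O' : set 'rV[R]_n)
    (h : 'rV[R]_m -> 'rV[R]_n) (phi : 'rV[R]_n -> R) :
  open O -> (forall x, O x -> O' (h x)) -> smooth_mx O h ->
  Ck k O' phi -> Ck k O (phi \o h).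
Proof.
move=> oO hO sh; elim: k phi => [|k IH] phi /= [d D].
all: have dc x : O x -> differentiable (phi \o h) x by
  move=> Ox; apply: differentiable_comp (d _ (hO _ Ox));
  exact: smooth_mx_differentiable sh Ox.
all: split=> // v.
have S : Ck k O (fun x => \sum_j 'D_v (fun y => h y 0 j) x *
    ('D_(delta_mx 0 j) phi \o h) x).
  elim: (index_enum _) => [|j r IHr].
    by apply: Ck_ext (Ck_cst k O 0) => // x _; rewrite big_nil.
  apply: Ck_ext (CkD oO (CkM oO (smooth_derive v (sh 0 j) k) (IH _ (D _))) IHr) => //.
  by move=> x _; rewrite big_cons.
apply: Ck_ext S => // x Ox.
have dh := smooth_mx_differentiable sh Ox.
apply/esym; rewrite deriveE; last exact: dc.
rewrite diff_comp /=; [|by []|exact/d/hO].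
rewrite linear_rV_form /rV_form; apply: eq_bigr => j _.
by rewrite -!deriveE ?coord_derive//; [exact: diff_derivable|exact/d/hO].
Qed.

Lemma smooth_comp m n (O : set 'rV[R]_m) (O' : set 'rV[R]_n)
    (h : 'rV[R]_m -> 'rV[R]_n) (phi : 'rV[R]_n -> R) :
  open O -> (forall x, O x -> O' (h x)) -> smooth_mx O h ->
  smooth O' phi -> smooth O (phi \o h).
Proof. by move=> oO hO sh s k; apply: Ck_comp (s k). Qed.

Lemma C1_coord_differentiable m n (O : set 'rV[R]_m) (f : 'rV[R]_m -> 'rV[R]_n) x j :
  open O -> O x -> (forall v y, O y -> derivable f y v) ->
  (forall v, {for x, continuous ('D_v f)}) ->
  differentiable (fun y => f y 0 j) x.
Proof.
move=> oO Ox df cDf; have nO : nbhs x O by exact: open_nbhs_nbhs.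
apply: C1_differentiable => [|i].
  by apply: filterS nO => y Oy i; exact: (derivable_mxP _ _ _).1 (df _ _ Oy) _ _.
have cD : {for x, continuous (fun y => 'D_(delta_mx 0 i) f y 0 j)}.
  apply: (@continuous_comp _ _ _ ('D_(delta_mx 0 i) f) (fun M : 'rV[R]_n => M 0 j)).
    exact: cDf.
  exact: coord_continuous.
apply: near_eq_continuous cD.
by apply: filterS nO => y Oy; rewrite -coord_derive //; exact: df.
Qed.

Lemma Ck_on_coord k m n (O : set 'rV[R]_m) (f : 'rV[R]_m -> 'rV[R]_n) j :
  open O -> Ck_on k.+1 O f -> Ck k O (fun x => f x 0 j).
Proof.
move=> oO; elim: k f => [|k IH] f [cf Df].
  split=> // x Ox; apply: (C1_coord_differentiable _ oO Ox) => v.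
    exact: (Df v).1.
  by have [_ [cD _]] := Df v; exact: cD x Ox.
split=> [x Ox|v].
  apply: (C1_coord_differentiable _ oO Ox) => v; first exact: (Df v).1.
  by have [_ [cD _]] := Df v; exact: cD x Ox.
apply: Ck_ext (IH _ (Df v).2) => // x Ox.
by apply: coord_derive; exact: (Df v).1.
Qed.

Lemma smooth_on_coord m n (O : set 'rV[R]_m) (f : 'rV[R]_m -> 'rV[R]_n) :
  open O -> smooth_on O f -> smooth_mx O f.
Proof. by move=> oO s i j k; rewrite (ord1 i); exact: Ck_on_coord (s k.+1). Qed.

End Gradient.

(** * Uniform estimates on closed balls *)

Section Estimates.
Variable R : realType.

Definition cball n (x : 'rV[R]_n) r : set 'rV[R]_n := [set y | `|y - x| <= r].

Lemma cball_compact n (x : 'rV[R]_n) r : compact (cball x r).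
Proof.
apply: bounded_closed_compact.
  exists (`|x| + r); split; first exact: num_real.
  move=> M /ltW rM y /= yx; apply: le_trans rM.
  by rewrite -[y](subrK x) (le_trans (ler_normD _ _))// addrC lerD2l.
have -> : cball x r = (fun y => `|y - x|) @^-1` [set t : R | t <= r] by [].
apply: closed_comp; last exact: closed_le.
move=> y _; apply: (@continuous_comp _ _ _ (fun y : 'rV[R]_n => y - x) Num.norm).
  by apply: (@continuousB _ _ _ id (cst x)) => //; exact: cst_continuous.
exact: norm_continuous.
Qed.

Lemma cball_center n (x : 'rV[R]_n) r : 0 <= r -> cball x r x.
Proof. by rewrite /cball /= subrr normr0. Qed.

Lemma cball_le n (x : 'rV[R]_n) r s : r <= s -> cball x r `<=` cball x s.
Proof. by move=> rs y; rewrite /cball /= => /le_trans; apply. Qed.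

Lemma cball_segment n (x : 'rV[R]_n) r a b (t : R) : 0 <= t <= 1 ->
  cball x r a -> cball x r b -> cball x r (t *: (b - a) + a).
Proof.
rewrite /cball /= => /andP[t0 t1] ar br.
have -> : t *: (b - a) + a - x = t *: (b - x) + (1 - t) *: (a - x).
  by apply/rowP => i; rewrite !mxE; ring.
rewrite (le_trans (ler_normD _ _))// !normrZ ger0_norm// ger0_norm ?subr_ge0//.
rewrite (le_trans (lerD (ler_wpM2l t0 br) (ler_wpM2l _ ar))) ?subr_ge0//.
by rewrite -mulrDl addrCA subrr addr0 mul1r.
Qed.

Lemma nbhs_cball n (x : 'rV[R]_n) (P : set 'rV[R]_n) :
  nbhs x P -> exists2 r, 0 < r & cball x r `<=` P.
Proof.
move=> /nbhs_ballP[e /= e0 eP]; exists (e / 2); first by rewrite divr_gt0.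
move=> y /= xy; apply: eP; rewrite -ball_normE /= distrC.
by rewrite (le_lt_trans xy)// ltr_pdivrMr// mulr_natr mulr2n ltrDl.
Qed.

Lemma cball_nbhs n (x : 'rV[R]_n) r : 0 < r -> nbhs x (cball x r).
Proof.
move=> r0; apply/nbhs_ballP; exists r => //= y.
by rewrite -ball_normE /= distrC => /ltW.
Qed.

Lemma ler_norm_mulmx m n p (A : 'M[R]_(m, n)) (B : 'M[R]_(n, p)) :
  `|A *m B| <= n%:R * (`|A| * `|B|).
Proof.
apply: mx_norm_le => [|i j]; first by rewrite mulr_ge0 ?mulr_ge0.
rewrite mxE (le_trans (ler_norm_sum _ _ _))//.
apply: (@le_trans _ _ (\sum_(k < n) `|A| * `|B|)).
  by apply: ler_sum => k _; rewrite normrM ler_pM// ler_coord_norm.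
by rewrite sumr_const card_ord -[X in X <= _]mulr_natl.
Qed.

Lemma common_bound (I : finType) (T : Type) (S : set T) (F : I -> T -> R) (w : T -> R) :
  (forall t, S t -> 0 <= w t) ->
  (forall i, exists2 C, 0 <= C & forall t, S t -> F i t <= C * w t) ->
  exists2 C, 0 <= C & forall i t, S t -> F i t <= C * w t.
Proof.
move=> w0 FC.
have /choice[C CF] i : exists C, 0 <= C /\ forall t, S t -> F i t <= C * w t.
  by have [C C0 HC] := FC i; exists C.
exists (\sum_i C i); first by apply: sumr_ge0 => i _; case: (CF i).
move=> i t St; apply: le_trans ((CF i).2 t St) _; apply: ler_wpM2r; first exact: w0.
by rewrite (bigD1 i)//= lerDl sumr_ge0// => j _; case: (CF j).
Qed.

Section Ball.
Variables (n : nat) (O : set 'rV[R]_n) (x0 : 'rV[R]_n) (r : R).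
Hypotheses (oO : open O) (rO : cball x0 r `<=` O).

Lemma smooth_bounded phi : smooth O phi ->
  exists2 C, 0 <= C & forall y, cball x0 r y -> `|phi y| <= C.
Proof.
move=> s.
have : compact (phi @` cball x0 r).
  apply: continuous_compact; last exact: cball_compact.
  apply: continuous_in_subspaceT => y /[!inE] /rO Oy.
  exact: smooth_continuous s Oy.
move=> /compact_bounded[M [_ HM]].
exists (`|M| + 1); first by rewrite addr_ge0.
move=> y yr; apply: (HM (`|M| + 1)); last by exists y.
by rewrite (le_lt_trans (ler_norm M))// ltrDl.
Qed.

Lemma smooth_mx_bounded a b (M : 'rV[R]_n -> 'M[R]_(a, b)) : smooth_mx O M ->
  exists2 C, 0 <= C & forall y, cball x0 r y -> `|M y| <= C.
Proof.
move=> s.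
have [|C C0 HC] := @common_bound _ _ (cball x0 r)
    (fun ij y => `|M y ij.1 ij.2|) (fun=> 1) (fun _ _ => ler01).
  move=> [i j]; have [C C0 HC] := smooth_bounded (s i j).
  by exists C => // y yr; rewrite mulr1; exact: HC.
exists C => // y yr; apply: mx_norm_le => // i j.
by have := HC (i, j) y yr; rewrite mulr1.
Qed.

Lemma smooth_mvt phi a b : smooth O phi -> cball x0 r a -> cball x0 r b ->
  exists2 c, cball x0 r c /\ `|c - a| <= `|b - a| &
    phi b - phi a = ((b - a) *m grad phi c) 0 0.
Proof.
move=> s ar br.
have seg (t : R) : 0 <= t <= 1 -> cball x0 r (t *: (b - a) + a).
  by move=> t01; apply: cball_segment.
have d (t : R) : 0 <= t <= 1 -> differentiable phi (t *: (b - a) + a).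
  by move=> t01; apply: (smooth_differentiable s); apply/rO/seg.
have [|t t01] := @mvt_segment R _ phi a (b - a).
  by move=> t t01; apply: diff_derivable; exact: d.
rewrite subrK => ->; exists (t *: (b - a) + a); last by rewrite derive_grad//; exact: d.
split; first exact: seg.
rewrite addrK normrZ; case/andP: t01 => t0 t1.
by rewrite ger0_norm// ler_piMl.
Qed.

Lemma smooth_lip phi : smooth O phi ->
  exists2 C, 0 <= C & forall a b, cball x0 r a -> cball x0 r b ->
    `|phi b - phi a| <= C * `|b - a|.
Proof.
move=> s; have [C C0 HC] := smooth_mx_bounded (smooth_grad oO s).
exists (n%:R * C); first by rewrite mulr_ge0.
move=> a b ar br; have [c [cr _] ->] := smooth_mvt s ar br.
apply: le_trans (ler_coord_norm _ _ _) _.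
apply: le_trans (ler_norm_mulmx _ _) _.
by rewrite -mulrA ler_wpM2l// mulrC ler_wpM2r// HC.
Qed.

Lemma smooth_mx_lip p q (M : 'rV[R]_n -> 'M[R]_(p, q)) : smooth_mx O M ->
  exists2 C, 0 <= C & forall a b, cball x0 r a -> cball x0 r b ->
    `|M b - M a| <= C * `|b - a|.
Proof.
move=> s.
have [||C C0 HC] := @common_bound _ _ (cball x0 r `*` cball x0 r)
    (fun ij ab => `|M ab.2 ij.1 ij.2 - M ab.1 ij.1 ij.2|) (fun ab => `|ab.2 - ab.1|).
- by [].
- move=> [i j]; have [C C0 HC] := smooth_lip (s i j).
  by exists C => // -[a b] [/= ar br]; exact: HC.
exists C => // a b ar br; apply: mx_norm_le => [|i j]; first by rewrite mulr_ge0.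
by rewrite !mxE; exact: (HC (i, j) (a, b)).
Qed.

(** By the mean value theorem the error is [b - a] times the difference of two
    gradients at distance at most [`|b - a|]. *)
Lemma smooth_taylor phi : smooth O phi ->
  exists2 C, 0 <= C & forall a b, cball x0 r a -> cball x0 r b ->
    `|phi b - phi a - ((b - a) *m grad phi a) 0 0| <= C * `|b - a| ^+ 2.
Proof.
move=> s; have [C C0 HC] := smooth_mx_lip (smooth_grad oO s).
exists (n%:R * C); first by rewrite mulr_ge0.
move=> a b ar br; have [c [cr ca] ->] := smooth_mvt s ar br.
have -> : ((b - a) *m grad phi c) 0 0 - ((b - a) *m grad phi a) 0 0 =
    ((b - a) *m (grad phi c - grad phi a)) 0 0 by rewrite mulmxBr !mxE.
apply: le_trans (ler_coord_norm _ _ _) _.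
apply: le_trans (ler_norm_mulmx _ _) _.
rewrite -mulrA ler_wpM2l// expr2 mulrCA ler_wpM2l//.
by apply: le_trans (HC _ _ ar cr) _; rewrite ler_wpM2l.
Qed.

End Ball.
End Estimates.

(** * Lipschitz retraction onto a level set *)

Section Retraction.
Variable R : realType.

(** A minimum of [`|f u - u|] on [U] vanishes, since applying [f] once more would
    halve it. *)
Lemma contraction_fixpoint k (U : set 'rV[R]_k) (f : 'rV[R]_k -> 'rV[R]_k) :
  compact U -> U !=set0 -> (forall u, U u -> U (f u)) ->
  (forall u v, U u -> U v -> `|f u - f v| <= 2^-1 * `|u - v|) ->
  exists2 u, U u & f u = u.
Proof.
move=> cU U0 fU fc.
have cf : {within U, continuous (fun u => `|f u - u|)}.
  apply/subspace_continuousP => u Uu; apply/cvgrPdist_le => e e0.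
  rewrite near_withinE; apply: filterS (cball_nbhs u (divr_gt0 e0 (ltr0n R 2))) => v.
  rewrite /cball /= => uv Uv; apply: le_trans (ler_dist_dist _ _) _.
  have -> : f u - u - (f v - v) = (f u - f v) + (v - u).
    by apply/rowP => i; rewrite !mxE; ring.
  apply: le_trans (ler_normD _ _) _; have := fc u v Uu Uv.
  by rewrite (distrC u v); lra.
have [u /[!inE] Uu um] := EVT_min_rV U0 cU cf.
exists u => //; apply/eqP; rewrite -subr_eq0 -normr_le0.
have := um (f u); rewrite inE => /(_ (fU _ Uu)) h1.
have := fc (f u) u (fU _ Uu) Uu; lra.
Qed.

(** When [B] is a left inverse of the derivative of [G] at a point, these
    inequalities hold nearby. The first makes [B *m Jac G y] invertible with a
    uniform bound; by the second, multiplication by [B *m Jac G y - 1%:M] shrinks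
    vectors of length [k] at least by half. *)
Definition regular_set N k (O : set 'rV[R]_N) (G : 'rV[R]_N -> 'rV[R]_k)
    (B : 'M[R]_(k, N)) : set 'rV[R]_N :=
  [set y | [/\ O y, 2^-1 <= \det (B *m Jac G y) &
               `|B *m Jac G y - 1%:M| <= (2 * k.+1%:R)^-1]].

Section LevelSet.
Variables (N k : nat) (O : set 'rV[R]_N) (G : 'rV[R]_N -> 'rV[R]_k) (x0 : 'rV[R]_N).
Variable B : 'M[R]_(k, N).
Hypotheses (oO : open O) (sG : smooth_mx O G) (Ox0 : O x0) (Gx0 : G x0 = 0).
Hypothesis (BG : B *m Jac G x0 = 1%:M).

Lemma mx_near_le p q (M : 'rV[R]_N -> 'M[R]_(p, q)) e : smooth_mx O M -> 0 < e ->
  \forall y \near x0, `|M y - M x0| <= e.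
Proof.
move=> sM e0.
have : \forall y \near x0, forall ij : 'I_p * 'I_q,
    `|M x0 ij.1 ij.2 - M y ij.1 ij.2| <= e.
  apply: (@filter_forall _ _ _ (nbhs x0)) => -[i j] /=.
  by have /cvgrPdist_le := smooth_continuous (sM i j) Ox0; apply.
apply: filterS => y H; apply: mx_norm_le => [|i j]; first exact: ltW.
by rewrite !mxE distrC; exact: (H (i, j)).
Qed.

Let Q x := B *m Jac G x.

Lemma smooth_Q : smooth_mx O Q.
Proof. by apply: smooth_mulmx => //; [exact: smooth_mx_cst|exact: smooth_Jac]. Qed.

Lemma exists_regular_ball : exists2 r, 0 < r & cball x0 r `<=` regular_set O G B.
Proof.
apply: nbhs_cball.
have h1 : nbhs x0 O by exact: open_nbhs_nbhs.
have h2 : \forall y \near x0, `|\det (Q x0) - \det (Q y)| <= 2^-1.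
  have /cvgrPdist_le := smooth_continuous (smooth_det oO smooth_Q) Ox0.
  by apply; rewrite invr_gt0.
have h3 : \forall y \near x0, `|Q y - Q x0| <= (2 * k.+1%:R)^-1.
  by apply: (mx_near_le smooth_Q); rewrite invr_gt0 mulr_gt0.
have Q1 : Q x0 = 1%:M by [].
rewrite Q1 det1 in h2; rewrite Q1 in h3.
near=> y; split; last by near: y.
  by near: y.
have : `|1 - \det (Q y)| <= 2^-1 by near: y.
by rewrite ler_norml; lra.
Unshelve. all: by end_near. Qed.

(** On [regular_set] the map [u |-> u - G (z + u *m B)] is a contraction of ratio
    [1/2], and its fixed point [u z] satisfies [G (z + u z *m B) = 0]. The fixed
    point depends on [z] in a Lipschitz way and is [0] on the level set, so
    [z + u z *m B] retracts a ball onto the level set. This replaces the implicit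
    function theorem: Lipschitz chains of points of the level set are all that is
    needed to integrate along it. *)
Lemma level_set_retraction r : 0 < r -> cball x0 r `<=` regular_set O G B ->
  exists s L rho, [/\ 0 < s, 0 <= L,
    forall z, cball x0 s z -> cball x0 r (rho z) /\ G (rho z) = 0,
    forall z, cball x0 s z -> G z = 0 -> rho z = z &
    forall z z', cball x0 s z -> cball x0 s z' -> `|rho z - rho z'| <= L * `|z - z'|].
Proof.
move=> r0 good.
have rO : cball x0 r `<=` O by move=> y /good[].
(* [sg] bounds [u], and [s] bounds [z - x0]: [z + u *m B] stays in the ball. *)
pose b := k%:R * `|B|; have b0 : 0 <= b by rewrite mulr_ge0.
pose sg := r / (2 * (b + 1)); have sg0 : 0 < sg.
  by rewrite divr_gt0// mulr_gt0// ltr_wpDl.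
have sgb : sg * b <= r / 2.
  have : sg * (b + 1) = r / 2 by rewrite /sg; field; rewrite lt0r_neq0// ltr_wpDl.
  lra.
have [C C0 HC] := smooth_mx_lip oO rO sG.
have [s1 s10 Hs1] : exists2 s, 0 < s & cball x0 s `<=` [set z | `|G z - G x0| <= sg / 2].
  by apply: nbhs_cball; apply: mx_near_le => //; rewrite divr_gt0.
pose s := Num.min s1 (r / 2).
have s0 : 0 < s by rewrite lt_min s10 divr_gt0.
have sr : s <= r / 2 by rewrite ge_min lexx orbT.
have Gs z : cball x0 s z -> `|G z| <= sg / 2.
  move=> /(@cball_le _ _ _ _ s1); rewrite ge_min lexx => /(_ isT)/Hs1 /=.
  by rewrite Gx0 subr0.
have uBb (u : 'rV[R]_k) : `|u *m B| <= `|u| * b.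
  by apply: le_trans (ler_norm_mulmx _ _) _; rewrite mulrCA.
have inr z u : cball x0 s z -> `|u| <= sg -> cball x0 r (z + u *m B).
  rewrite /cball /= => zs us; rewrite addrAC (le_trans (ler_normD _ _))//.
  have := uBb u; have := ler_wpM2r b0 us; lra.
have ctr z u u' : cball x0 s z -> `|u| <= sg -> `|u'| <= sg ->
    `|(u - G (z + u *m B)) - (u' - G (z + u' *m B))| <= 2^-1 * `|u - u'|.
  move=> zs us us'; apply: rV_norm_le => [|l]; first by rewrite mulr_ge0// invr_ge0.
  have [c [cr _] E] := smooth_mvt rO (sG 0 l) (inr _ _ zs us') (inr _ _ zs us).
  have -> : ((u - G (z + u *m B)) - (u' - G (z + u' *m B))) 0 l =
      ((u - u') *m (1%:M - Q c)) 0 l.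
    have -> : ((u - u') *m (1%:M - Q c)) 0 l =
        (u - u') 0 l - ((z + u *m B - (z + u' *m B)) *m Jac G c) 0 l.
      rewrite mulmxBr mulmx1 [LHS]mxE [X in _ + X = _]mxE /Q mulmxA; congr (_ - (_ *m _) _ _).
      by rewrite opprD addrACA subrr add0r mulmxBl.
    have -> : ((z + u *m B - (z + u' *m B)) *m Jac G c) 0 l =
        ((z + u *m B - (z + u' *m B)) *m grad (fun y => G y 0 l) c) 0 0.
      by rewrite -col_Jac !mxE; apply: eq_bigr => i _; rewrite !mxE.
    by rewrite -E !mxE; ring.
  apply: le_trans (ler_coord_norm _ _ _) _.
  apply: le_trans (ler_norm_mulmx _ _) _.
  have [_ _ H] := good c cr; rewrite distrC in H.
  apply: le_trans (ler_wpM2l _ (ler_wpM2l _ H)) _ => //.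
  rewrite mulrA mulrAC ler_wpM2r// ler_pdivrMr ?mulr_gt0//.
  by rewrite mulrA mulVf// mul1r ler_nat.
have /choice[u Hu] z : exists u, cball x0 s z -> `|u| <= sg /\ G (z + u *m B) = 0.
  have [zs|nzs] := pselect (cball x0 s z); last by exists 0.
  have [|v vU|v v' vU vU'|u uU fu] := @contraction_fixpoint k (cball 0 sg)
    (fun u => u - G (z + u *m B)) (@cball_compact _ _ _ _).
  - by exists 0; apply: cball_center; exact: ltW.
  - have vs : `|v| <= sg by move: vU; rewrite /cball /= subr0.
    have zs0 : `|(0 : 'rV[R]_k)| <= sg by rewrite normr0 ltW.
    have := ctr z v 0 zs vs zs0; rewrite mul0mx addr0 sub0r opprK subr0 => h.
    rewrite /cball /= subr0.
    have -> : v - G (z + v *m B) = (v - G (z + v *m B) + G z) - G z by rewrite addrK.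
    apply: le_trans (ler_normB _ _) _; have := Gs z zs; lra.
  - by apply: ctr => //; [move: vU|move: vU']; rewrite /cball /= subr0.
  exists u => _; split; first by move: uU; rewrite /cball /= subr0.
  by apply/eqP; rewrite -oppr_eq0 -(addrK u (- G _)) [- _ + u]addrC fu subrr.
have zr z : cball x0 s z -> cball x0 r z.
  by apply: cball_le; move: sr r0; lra.
pose rho z := z + u z *m B.
have ulip z z' : cball x0 s z -> cball x0 s z' -> `|u z - u z'| <= 2 * C * `|z - z'|.
  move=> zs zs'; have [u1 G1] := Hu z zs; have [u2 G2] := Hu z' zs'.
  have h1 := ctr z _ _ zs u1 u2.
  have h2 := HC _ _ (inr _ _ zs' u2) (inr _ _ zs u2).
  rewrite G2 subr0 opprD addrACA subrr addr0 in h2.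
  rewrite G1 subr0 in h1.
  have E : u z - u z' = (u z - (u z' - G (z + u z' *m B))) - G (z + u z' *m B).
    by apply/rowP => i; rewrite !mxE; ring.
  have := ler_normB (u z - (u z' - G (z + u z' *m B))) (G (z + u z' *m B)).
  rewrite -E; lra.
exists s, (1 + 2 * C * b), rho; split=> //.
- by rewrite addr_ge0// mulr_ge0// mulr_ge0.
- by move=> z zs; have [uz Gz] := Hu z zs; split=> //; exact: inr.
- move=> z zs Gz; have [uz Guz] := Hu z zs.
  have zs0 : `|(0 : 'rV[R]_k)| <= sg by rewrite normr0 ltW.
  have := ctr z (u z) 0 zs uz zs0.
  rewrite Guz mul0mx addr0 Gz !subr0 => h.
  have : `|u z| <= 0 by move: h; lra.
  by rewrite normr_le0 => /eqP u0; rewrite /rho u0 mul0mx addr0.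
move=> z z' zs zs'; rewrite /rho opprD addrACA -mulmxBl.
apply: le_trans (ler_normD _ _) _.
have := uBb (u z - u z'); have := ler_wpM2r b0 (ulip _ _ zs zs'); lra.
Qed.

End LevelSet.
End Retraction.

(** * Functions with vanishing tangential derivatives *)

Section FlatFunctions.
Variables (R : realType) (N k : nat) (O : set 'rV[R]_N) (G : 'rV[R]_N -> 'rV[R]_k).
Variables (x0 : 'rV[R]_N) (B : 'M[R]_(k, N)).
Hypotheses (oO : open O) (sG : smooth_mx O G).

(** The vectors [v *m (1 - Jac G x *m Q^-1 *m B)], for [Q := B *m Jac G x], are
    the tangent vectors of the level set of [G], and [tang_grad] is the gradient
    of [phi] along them. The factor [\det Q] replaces [Q^-1] by [\adj Q] and
    makes the entries polynomial in derivatives of [phi] and [G], so that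
    [tang i] maps smooth functions to smooth functions. *)
Definition tang_grad (phi : 'rV[R]_N -> R) x : 'cV[R]_N :=
  \det (B *m Jac G x) *: grad phi x -
  Jac G x *m (\adj (B *m Jac G x) *m (B *m grad phi x)).

Definition tang i (phi : 'rV[R]_N -> R) x := tang_grad phi x i 0.

(** All the iterated tangential derivatives of [phi] at [x], of orders [1] to [K],
    vanish. *)
Fixpoint flat K (phi : 'rV[R]_N -> R) x : Prop :=
  if K is K'.+1 then forall i, tang i phi x = 0 /\ flat K' (tang i phi) x
  else True.

Lemma smooth_normal phi : smooth O phi ->
  smooth_mx O (fun x => \adj (B *m Jac G x) *m (B *m grad phi x)).
Proof.
move=> s; apply: smooth_mulmx => //.
  by apply: smooth_adj => //; exact: smooth_Q.
by apply: smooth_mulmx => //; [exact: smooth_mx_cst|exact: smooth_grad].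
Qed.

Lemma smooth_tang i phi : smooth O phi -> smooth O (tang i phi).
Proof.
move=> s; apply: (@smooth_mxB _ _ O oO N 1%N _ _ _ _ i 0).
  apply: smooth_mxZ => //; last exact: smooth_grad.
  by apply: smooth_det => //; exact: smooth_Q.
by apply: smooth_mulmx => //; [exact: smooth_Jac|exact: smooth_normal].
Qed.

Lemma tangD_span phi x (c : 'cV[R]_k) :
  grad phi x = Jac G x *m c -> tang_grad phi x = 0.
Proof.
move=> E; rewrite /tang_grad E !mulmxA -(mulmxA (Jac G x) _ B) -(mulmxA (Jac G x)).
rewrite -(mulmxA _ B) mul_adj_mx mul_mx_scalar -scalemxAl.
by rewrite subrr.
Qed.

(** For [a] and [b] on the level set, [v := b - a] satisfies
    [v *m Jac G a = O(`|v| ^+ 2)]; so only the tangential part of the gradient of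
    [phi] contributes to first order. *)
Lemma flat_step r phi : smooth O phi -> cball x0 r `<=` regular_set O G B ->
  exists2 C, 0 <= C & forall a b, cball x0 r a -> cball x0 r b -> G a = 0 -> G b = 0 ->
    `|phi b - phi a| <= 2 * (N%:R * (`|b - a| * `|tang_grad phi a|)) + C * `|b - a| ^+ 2.
Proof.
move=> s good; have rO : cball x0 r `<=` O by move=> y /good[].
have [C1 C10 H1] := smooth_taylor oO rO s.
have [||C2 C20 H2] := @common_bound R 'I_k _ (cball x0 r `*` cball x0 r)
  (fun j ab => `|G ab.2 0 j - G ab.1 0 j - ((ab.2 - ab.1) *m Jac G ab.1) 0 j|)
  (fun ab => `|ab.2 - ab.1| ^+ 2).
- by move=> ab _; rewrite exprn_ge0.
- move=> j; have [C C0 HC] := smooth_taylor oO rO (sG 0 j).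
  exists C => // -[a b] [/= ar br]; have := HC a b ar br.
  by rewrite -col_Jac colE mulmxA -colE mxE.
have [C3 C30 H3] := smooth_mx_bounded rO (smooth_normal s).
exists (C1 + 2 * (k%:R * (C2 * C3))); first by rewrite addr_ge0 ?mulr_ge0.
move=> a b ar br Ga Gb; set v := b - a.
have [_ dQ _] := good a ar.
have vG : `|v *m Jac G a| <= C2 * `|v| ^+ 2.
  apply: rV_norm_le => [|j]; first by rewrite mulr_ge0 ?exprn_ge0.
  have := H2 j (a, b) (conj ar br); rewrite /= Ga Gb !mxE subrr sub0r normrN.
  by under eq_bigr do rewrite mxE.
have T := H1 a b ar br; rewrite -/v in T.
set d := \det _ in dQ.
have E : d * (v *m grad phi a) 0 0 = (v *m tang_grad phi a) 0 0 +
    (v *m Jac G a *m (\adj (B *m Jac G a) *m (B *m grad phi a))) 0 0.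
  rewrite /tang_grad mulmxBr -scalemxAr -/d -mulmxA.
  by rewrite !mxE subrK.
have b1 : `|(v *m tang_grad phi a) 0 0| <= N%:R * (`|v| * `|tang_grad phi a|).
  exact: le_trans (ler_coord_norm _ _ _) (ler_norm_mulmx _ _).
have b2 : `|(v *m Jac G a *m (\adj (B *m Jac G a) *m (B *m grad phi a))) 0 0| <=
    k%:R * (C2 * `|v| ^+ 2 * C3).
  apply: le_trans (ler_coord_norm _ _ _) _.
  apply: le_trans (ler_norm_mulmx _ _) _.
  by rewrite ler_wpM2l// ler_pM// H3.
have b3 : `|(v *m grad phi a) 0 0| <= 2 * (d * `|(v *m grad phi a) 0 0|).
  by rewrite mulrA ler_peMl//; move: dQ; lra.
have d0 : 0 <= d by move: dQ; lra.
have b4 : d * `|(v *m grad phi a) 0 0| <=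
    N%:R * (`|v| * `|tang_grad phi a|) + k%:R * (C2 * `|v| ^+ 2 * C3).
  rewrite -{1}(ger0_norm d0) -normrM E; apply: le_trans (ler_normD _ _) _.
  exact: lerD.
have -> : phi b - phi a = (phi b - phi a - (v *m grad phi a) 0 0) + (v *m grad phi a) 0 0.
  by rewrite subrK.
apply: le_trans (ler_normD _ _) _; apply: le_trans (lerD T (le_trans b3 (ler_wpM2l _ b4))) _ => //.
by rewrite le_eqVlt; apply/orP; left; apply/eqP; ring.
Qed.

Lemma le_of_le_add_inv (x a b : R) : (forall n, x <= a + b / n.+1%:R) -> x <= a.
Proof.
move=> H; rewrite leNgt; apply/negP => ax.
have b0 : 0 < b by have := H 0%N; rewrite divr1; lra.
pose n := Num.truncn (b / (x - a)).
have : b / (x - a) < n.+1%:R by exact: truncnS_gt.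
rewrite ltr_pdivrMr ?subr_gt0// => h.
have := H n; rewrite leNgt => /negP; apply.
by rewrite -ltrBrDl ltr_pdivrMr// mulrC.
Qed.

Section Chain.
Variables (r s L : R) (rho : 'rV[R]_N -> 'rV[R]_N).
Hypothesis good : cball x0 r `<=` regular_set O G B.
Hypotheses (L0 : 0 <= L)
  (rhoP : forall z, cball x0 s z -> cball x0 r (rho z) /\ G (rho z) = 0)
  (rhoL : forall z z', cball x0 s z -> cball x0 s z' -> `|rho z - rho z'| <= L * `|z - z'|).

(** Taylor's formula along the level set. The segment from [z] to [z'] is cut
    into [n.+1] pieces and retracted. By induction the tangential derivatives are
    [O(D ^+ K.+1)] on the resulting chain, for [D := `|z' - z|], so by
    [flat_step] each step contributes [O(D ^+ K.+2 / n) + O(1 / n ^+ 2)]. The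
    second terms disappear when [n] tends to infinity. *)
Lemma flat_estimate K phi : smooth O phi ->
  exists2 C, 0 <= C & forall z z', cball x0 s z -> cball x0 s z' -> flat K phi (rho z) ->
    `|phi (rho z') - phi (rho z)| <= C * `|z' - z| ^+ K.+1.
Proof.
have rO : cball x0 r `<=` O by move=> y /good[].
elim: K phi => [|K IH] phi sphi.
  have [C C0 HC] := smooth_lip oO rO sphi.
  exists (C * L); first by rewrite mulr_ge0.
  move=> z z' zs zs' _; have [zr _] := rhoP zs; have [zr' _] := rhoP zs'.
  apply: le_trans (HC _ _ zr zr') _.
  by rewrite expr1 -mulrA ler_wpM2l// rhoL.
have [||C1 C10 H1] := @common_bound R 'I_N _
  [set zz | [/\ cball x0 s zz.1, cball x0 s zz.2 & flat K.+1 phi (rho zz.1)]]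
  (fun i zz => `|tang i phi (rho zz.2)|)
  (fun zz : 'rV[R]_N * 'rV[R]_N => `|zz.2 - zz.1| ^+ K.+1).
- by move=> zz _; rewrite exprn_ge0.
- move=> i; have [C C0 HC] := IH _ (smooth_tang i sphi).
  exists C => // -[z z'] [/= zs zs' fl]; have [t0 fl'] := fl i.
  by have := HC z z' zs zs' fl'; rewrite t0 subr0.
have [C2 C20 H2] := flat_step sphi good.
exists (2 * (N%:R * (L * C1))); first by rewrite !mulr_ge0.
move=> z z' zs zs' fl; set D := `|z' - z|; have D0 : 0 <= D by rewrite /D normr_ge0.
apply: (@le_of_le_add_inv _ _ (C2 * (L * D) ^+ 2)) => n.
(* The points of the segment; [rho] moves them to the level set. *)
pose zt i := ((i%:R : R) / n.+1%:R) *: (z' - z) + z.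
have ti i : (i <= n.+1)%N -> 0 <= (i%:R : R) / n.+1%:R <= 1.
  by move=> ni; rewrite divr_ge0//= ler_pdivrMr// mul1r ler_nat.
have zts i : (i <= n.+1)%N -> cball x0 s (zt i) by move=> /ti t01; exact: cball_segment.
have -> : phi (rho z') - phi (rho z) =
    \sum_(i < n.+1) (phi (rho (zt i.+1)) - phi (rho (zt i))).
  rewrite -(big_mkord xpredT (fun i => phi (rho (zt i.+1)) - phi (rho (zt i)))).
  rewrite (@telescope_sumr _ 0 n.+1 (fun i => phi (rho (zt i)))) //.
  by rewrite /zt divff// scale1r subrK mul0r scale0r add0r.
have step (i : 'I_n.+1) : `|phi (rho (zt i.+1)) - phi (rho (zt i))| <=
    2 * (N%:R * ((L * (D / n.+1%:R)) * (C1 * D ^+ K.+1))) +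
    C2 * (L * (D / n.+1%:R)) ^+ 2.
  have il : (i <= n.+1)%N by exact/ltnW.
  have [ra Ga] := rhoP (zts i il); have [rb Gb] := rhoP (zts i.+1 (ltn_ord i)).
  have dz : `|rho (zt i.+1) - rho (zt i)| <= L * (D / n.+1%:R).
    apply: le_trans (rhoL _ _) _; [exact: zts|exact: zts|].
    rewrite ler_wpM2l// /zt opprD addrACA subrr addr0 -scalerBl -mulrBl.
    by rewrite -natrB// subSnn normrZ ger0_norm ?divr_ge0// mulrC mul1r.
  have tz : `|tang_grad phi (rho (zt i))| <= C1 * D ^+ K.+1.
    apply: mx_norm_le => [|j l]; first by rewrite mulr_ge0 ?exprn_ge0.
    rewrite (ord1 l); have := H1 j (z, zt i) (And3 zs (zts i il) fl) => /=.
    move=> h; apply: le_trans h _; rewrite ler_wpM2l// lerXn2r ?nnegrE//.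
    rewrite /zt addrK normrZ; case/andP: (ti i il) => t0 t1.
    by rewrite ger0_norm// ler_piMl.
  apply: le_trans (H2 _ _ ra rb Ga Gb) _; apply: lerD.
    by rewrite !ler_wpM2l// ler_pM.
  by rewrite ler_wpM2l// lerXn2r ?nnegrE// mulr_ge0// divr_ge0.
apply: le_trans (ler_norm_sum _ _ _) _.
apply: le_trans (ler_sum _ (fun i _ => step i)) _.
rewrite sumr_const card_ord -[X in X <= _]mulr_natr.
by rewrite le_eqVlt; apply/orP; left; apply/eqP; rewrite (exprS D K.+1); field.
Qed.

End Chain.
End FlatFunctions.

(** * Null sets *)

Section NullSets.
Variable R : realType.

Definition vol n (a b : 'rV[R]_n) : R := \prod_(i < n) (b 0 i - a 0 i).

Lemma vol_ge0 n (a b : 'rV[R]_n) : (forall i, a 0 i <= b 0 i) -> 0 <= vol a b.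
Proof. by move=> ab; apply: prodr_ge0 => i _; rewrite subr_ge0. Qed.

(** The condition of [lebesgue_null] for one value of [e], with any index type:
    covers indexed by pairs or by a finite type occur below. *)
Definition covered (T : choiceType) n (S : set 'rV[R]_n) (e : R) :=
  exists (K : set T) (a b : T -> 'rV[R]_n),
    [/\ forall k i, a k 0 i <= b k 0 i,
        S `<=` \bigcup_(k in K) box (a k) (b k) &
        (\esum_(k in K) (vol (a k) (b k))%:E <= e%:E)%E].

Lemma coveredS (T : choiceType) n (S S' : set 'rV[R]_n) e :
  S' `<=` S -> covered T S e -> covered T S' e.
Proof.
by move=> SS [K [a [b [ab Sab v]]]]; exists K, a, b; split=> // x /SS /Sab.
Qed.

Lemma covered_nat (T : countType) n (S : set 'rV[R]_n) e :
  covered T S e -> covered nat S e.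
Proof.
move=> [K [a [b [ab Sab v]]]].
(* Indices that encode nothing get the degenerate box at [0]. *)
pose a' k := if unpickle k is Some t then a t else 0.
pose b' k := if unpickle k is Some t then b t else 0.
exists (pickle @` K), a', b'; split.
- by move=> k i; rewrite /a' /b'; case: unpickle.
- move=> x /Sab[t Kt xt]; exists (pickle t); first by exists t.
  by rewrite /a' /b' pickleK.
rewrite esum_image; last first.
  by move=> x y _ _ /(congr1 (@unpickle T)); rewrite !pickleK => -[].
by rewrite /a' /b'; under eq_esum do rewrite pickleK.
Qed.

Lemma esum_subset (T : choiceType) (K K' : set T) (f : T -> \bar R) :
  K `<=` K' -> (\esum_(k in K) f k <= \esum_(k in K') f k)%E.
Proof.
move=> KK; apply: ereal_sup_le => _ [X [fX XK] <-].
by exists X => //; split=> // x /XK /KK.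
Qed.

Lemma covered_bigcup n (S : nat -> set 'rV[R]_n) (e : nat -> R) (e' : R) :
  (forall i, 0 <= e i) ->
  (forall i, covered nat (S i) (e i)) -> (\sum_(0 <= i <oo) (e i)%:E <= e'%:E)%E ->
  covered nat (\bigcup_i S i) e'.
Proof.
move=> e0 C ee.
have /choice[K HK] i : exists K : set nat * ((nat -> 'rV[R]_n) * (nat -> 'rV[R]_n)),
    [/\ forall k j, K.2.1 k 0 j <= K.2.2 k 0 j,
        S i `<=` \bigcup_(k in K.1) box (K.2.1 k) (K.2.2 k) &
        (\esum_(k in K.1) (vol (K.2.1 k) (K.2.2 k))%:E <= (e i)%:E)%E].
  by have [K [a [b H]]] := C i; exists (K, (a, b)).
apply: (@covered_nat (nat * nat)%type).
exists ([set: nat] `*`` (fun i => (K i).1)),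
  (fun p => (K p.1).2.1 p.2), (fun p => (K p.1).2.2 p.2); split.
- by move=> [i k] j /=; have [+ _ _] := HK i; apply.
- move=> x [i _ Six]; have [_ + _] := HK i => /(_ x Six)[k Kk xk].
  by exists (i, k).
rewrite -(@esum_esum _ _ _ setT (fun i => (K i).1)
  (fun i k => (vol ((K i).2.1 k) ((K i).2.2 k))%:E)) /=; last first.
  move=> i k _ _; rewrite lee_fin; apply: vol_ge0 => j.
  by have [+ _ _] := HK i; apply.
apply: le_trans ee; rewrite nneseries_esumT; last by move=> i; rewrite lee_fin.
by apply: le_esum => i _; have [] := HK i.
Qed.

Lemma covered_set0 n : covered nat (set0 : set 'rV[R]_n) 0.
Proof.
by exists set0, (fun=> 0), (fun=> 0); split=> //; rewrite esum_set0.
Qed.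

Lemma covered_bigcup_ord n N (S : nat -> set 'rV[R]_n) (e : R) :
  0 <= e -> (forall i, (i < N)%N -> covered nat (S i) e) ->
  covered nat (\bigcup_(i in [set i | (i < N)%N]) S i) (N%:R * e).
Proof.
move=> e0 C; pose S' i := if (i < N)%N then S i else set0.
pose e' i := if (i < N)%N then e else 0.
apply: (@coveredS _ _ (\bigcup_i S' i)).
  by move=> x [i /= iN Six]; exists i => //; rewrite /S' iN.
apply: (@covered_bigcup _ _ e').
- by move=> i; rewrite /e'; case: ifP.
- move=> i; rewrite /S' /e'; case: ifP => [iN|_]; first exact: C.
  exact: covered_set0.
rewrite (@nneseries_split _ _ 0 N) => [|k _]; last first.
  by rewrite lee_fin /e'; case: ifP.
rewrite add0n eseries0 => [|i Ni _]; last by rewrite /e' ltnNge Ni.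
rewrite adde0 big_mkord (eq_bigr (fun=> e%:E)).
  by rewrite sumEFin lee_fin sumr_const card_ord mulr_natl.
by move=> i _; rewrite /e' ltn_ord.
Qed.

(** Box [k] is enlarged on all sides, by so little that its volume grows by at
    most the share [2 ^ - k.+1] of [e' - e]. *)
Lemma covered_open n (S : set 'rV[R]_n) e e' : e < e' -> covered nat S e ->
  exists U, [/\ open U, S `<=` U & covered nat U e'].
Proof.
move=> ee [K [a [b [ab Sab v]]]].
have /choice[h Hh] k : exists h : R, 0 < h /\
    \prod_(i < n) (b k 0 i - a k 0 i + (h + h)) <=
      vol (a k) (b k) + (e' - e) / (2 ^ k.+1)%:R.
  pose f (h : R) := \prod_(i < n) (b k 0 i - a k 0 i + (h + h)).
  have cf : {for 0, continuous f}.
    apply: (@continuous_big _ _ _ _ _ mul_continuous) => i _ x.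
    apply: (@cvgD _ _ _ (nbhs x)); first exact: cvg_cst.
    by apply: (@cvgD _ _ _ (nbhs x)); exact: cvg_id.
  have d0 : 0 < (e' - e) / (2 ^ k.+1)%:R.
    by rewrite divr_gt0 ?subr_gt0// ltr0n expn_gt0.
  have f0 : f 0 = vol (a k) (b k).
    by rewrite /f /vol; under eq_bigr do rewrite addr0 addr0.
  have /cvgrPdist_le/(_ _ d0) /nbhs_ballP[r /= r0 Hr] := cf.
  exists (r / 2); split; first by rewrite divr_gt0.
  have hb : ball (0 : R) r (r / 2).
    rewrite -ball_normE /= sub0r normrN ger0_norm ?divr_ge0 ?ltW//.
    by rewrite ltr_pdivrMr// mulr_natr mulr2n ltrDl.
  have := Hr _ hb; rewrite /= f0 distrC => /(le_trans (ler_norm _)).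
  by rewrite lerBlDl.
pose obox k := [set v : 'rV[R]_n | forall i, a k 0 i - h k < v 0 i < b k 0 i + h k].
exists (\bigcup_(k in K) obox k); split.
- apply: bigcup_open => k _; rewrite openE => x xk.
  apply: (@filter_forall _ _ _ (nbhs x)) => i.
  have := xk i => /andP[x1 x2].
  have c : {for x, continuous (fun v : 'rV[R]_n => v 0 i)} by exact: coord_continuous.
  have : nbhs (x 0 i) [set t | a k 0 i - h k < t < b k 0 i + h k].
    have := @near_in_itvoo R (a k 0 i - h k) (b k 0 i + h k) (x 0 i).
    rewrite in_itv /= x1 x2 => /(_ isT); apply: filterS => t.
    by rewrite in_itv.
  by move=> /c.
- move=> x /Sab[k Kk xk]; exists k => // i.
  by have := xk i; have [hk _] := Hh k; move/andP => [x1 x2]; apply/andP; split; lra.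
exists K, (fun k => \row_i (a k 0 i - h k)), (fun k => \row_i (b k 0 i + h k)); split.
- by move=> k i; rewrite !mxE; have := ab k i; have [hk _] := Hh k; lra.
- by move=> x [k Kk xk]; exists k => // i; rewrite !mxE; have := xk i; lra.
apply: (@le_trans _ _ (\esum_(k in K) ((vol (a k) (b k))%:E + ((e' - e) / (2 ^ k.+1)%:R)%:E))%E).
  apply: le_esum => k _; rewrite -EFinD lee_fin; have [_ +] := Hh k.
  by apply: le_trans; rewrite /vol le_eqVlt; apply/orP; left; apply/eqP;
    apply: eq_bigr => i _; rewrite !mxE; ring.
have ee0 k : (0 <= ((e' - e) / (2 ^ k.+1)%:R)%:E)%E.
  by rewrite lee_fin divr_ge0 ?subr_ge0 ?ltW.
rewrite esumD //; last by move=> k _; rewrite lee_fin vol_ge0.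
have -> : e'%:E = (e%:E + (e' - e)%:E)%E by rewrite -EFinD addrC subrK.
apply: leeD => //; apply: le_trans (esum_subset _ (@subsetT _ K)) _.
rewrite -nneseries_esumT //; apply: epsilon_trick0; rewrite subr_ge0; exact: ltW.
Qed.

Lemma covered_slab p (j : 'I_p.+1) (U : set 'rV[R]_p) (s s' e : R) :
  s <= s' -> covered nat U e ->
  covered nat [set y : 'rV[R]_p.+1 | s <= y 0 j <= s' /\ U (col' j y)] ((s' - s) * e).
Proof.
move=> ss [K [a [b [ab Uab v]]]].
pose ext (c : 'rV[R]_p) (t : R) : 'rV[R]_p.+1 :=
  \row_i (if unlift j i is Some i' then c 0 i' else t).
have extj c t : ext c t 0 j = t by rewrite mxE unlift_none.
have extl c t i : ext c t 0 (lift j i) = c 0 i by rewrite mxE liftK.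
exists K, (fun k => ext (a k) s), (fun k => ext (b k) s'); split.
- by move=> k i; have [i'|] := unliftP j i => ->; rewrite ?extl ?extj.
- move=> y [yj Uy]; have [k Kk yk] := Uab _ Uy; exists k => // i.
  have [i'|] := unliftP j i => ->; rewrite ?extl ?extj//.
  by have := yk i'; rewrite mxE.
have volE k : vol (ext (a k) s) (ext (b k) s') = (s' - s) * vol (a k) (b k).
  rewrite /vol (bigD1_ord j) //= !extj; congr (_ * _).
  by apply: eq_bigr => i _; rewrite !extl.
under eq_esum do rewrite volE.
apply: ge_ereal_sup => _ [X [fX XK] <-].
under eq_fsbigr do rewrite EFinM.
rewrite -ge0_mule_fsumr; last by move=> k; rewrite lee_fin vol_ge0.
rewrite [X in (_ <= X)%E]EFinM lee_wpmul2l ?lee_fin ?subr_ge0//.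
by apply: le_trans v; apply: esum_ge; exists X.
Qed.

Lemma nullP n (S : set 'rV[R]_n) :
  lebesgue_null S <-> forall e, 0 < e -> covered nat S e.
Proof. by split=> H e e0; exact: H. Qed.

Lemma nullS n (S S' : set 'rV[R]_n) :
  S' `<=` S -> lebesgue_null S -> lebesgue_null S'.
Proof. by move=> SS H e e0; exact: coveredS SS (H e e0). Qed.

Lemma null_set0 n : lebesgue_null (set0 : set 'rV[R]_n).
Proof.
move=> e e0; have [K [a [b [ab S v]]]] := covered_set0 n.
by exists K, a, b; split=> //; apply: le_trans v _; rewrite lee_fin ltW.
Qed.

Lemma null_bigcup (T : countType) n (S : T -> set 'rV[R]_n) :
  (forall t, lebesgue_null (S t)) -> lebesgue_null (\bigcup_t S t).
Proof.
move=> H; pose S' k := if unpickle k is Some t then S t else set0.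
have H' k : lebesgue_null (S' k).
  by rewrite /S'; case: (unpickle k) => [t|]; [exact: H|exact: null_set0].
apply: (@nullS _ (\bigcup_k S' k)).
  by move=> x [t _ Stx]; exists (pickle t) => //; rewrite /S' pickleK.
move=> e e0; have de k : 0 < e / (2 ^ k.+1)%:R by rewrite divr_gt0// ltr0n expn_gt0.
apply: (@covered_bigcup _ _ (fun k => e / (2 ^ k.+1)%:R)) => //.
- by move=> k; exact: ltW.
- by move=> k; exact: H'.
by apply: epsilon_trick0; exact: ltW.
Qed.

Lemma null_setU n (S S' : set 'rV[R]_n) :
  lebesgue_null S -> lebesgue_null S' -> lebesgue_null (S `|` S').
Proof.
move=> H H'; apply: (@nullS _ (\bigcup_(b : bool) (if b then S else S'))).
  by move=> x [Sx|Sx]; [exists true|exists false].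
by apply: null_bigcup => -[].
Qed.

(** Countably many members [W] of a basis have a null [h @` (E `&` W)], and they
    cover [E]. *)
Lemma null_of_locally (T : topologicalType) n (E : set T) (h : T -> 'rV[R]_n) :
  @second_countable T ->
  (forall x, E x -> exists2 V, nbhs x V & lebesgue_null (h @` (E `&` V))) ->
  lebesgue_null (h @` E).
Proof.
move=> [Bs /countable_injP[f finj] [oB bB]] H.
pose S k := \bigcup_(V in [set V | Bs V /\ f V = k /\ lebesgue_null (h @` (E `&` V))])
  (h @` (E `&` V)).
apply: (@nullS _ (\bigcup_k S k)).
  move=> _ [x Ex <-]; have [V Vx HV] := H x Ex.
  have [W [BW Wx] WV] := bB x V Vx.
  exists (f W) => //; exists W; last by exists x.
  by split=> //; split=> //; apply: nullS HV; apply: image_subset; exact: setIS.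
apply: null_bigcup => k.
have [[V [BV [fV HV]]]|nV] := pselect (exists V, Bs V /\ f V = k /\
    lebesgue_null (h @` (E `&` V))); last first.
  apply: (@nullS _ set0); last exact: null_set0.
  by move=> x [V HV]; case: nV; exists V.
apply: nullS HV => x [W [BW [fW _]]].
by have -> : W = V by apply: finj; rewrite ?inE// fW.
Qed.

(** An open cover of one slice of the compact set [S] also covers the nearby
    slices. By compactness of the range of the coordinate [j], some width is
    small enough for slabs of this width around every slice to be covered
    in this way; the volumes of the covers add up to the total width of the slabs times
    the bound for one slice. *)
Lemma null_fubini p (j : 'I_p.+1) (S : set 'rV[R]_p.+1) : compact S ->
  (forall t, lebesgue_null (col' j @` (S `&` [set y | y 0 j = t]))) ->
  lebesgue_null S.
Proof.
move=> cS sl; apply/nullP => e e0.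
have [M M0 SM] : exists2 M, 0 < M & forall y, S y -> `|y| <= M.
  have [M [_ HM]] := compact_bounded cS.
  exists (`|M| + 1); first by rewrite ltr_wpDl.
  by move=> y; apply: HM; rewrite (le_lt_trans (ler_norm M))// ltrDl.
have ccol : continuous (col' j : 'rV[R]_p.+1 -> 'rV[R]_p).
  move=> y; apply: (@cvg_rV R _ (nbhs y)) => i.
  rewrite [X in _ --> X]mxE; under eq_fun do rewrite mxE.
  exact: coord_continuous.
pose eps := e / (2 * M); have eps0 : 0 < eps by rewrite divr_gt0// mulr_gt0.
have loc (t : R) : exists U, covered nat U eps /\
    \forall t' \near t, forall y, S y -> y 0 j = t' -> U (col' j y).
  have e2 : 0 < eps / 2 by rewrite divr_gt0.
  have ee : eps / 2 < eps by rewrite ltr_pdivrMr// mulr_natr mulr2n ltrDl.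
  have [U [oU SU CU]] := covered_open ee (sl t _ e2).
  exists U; split=> //.
  pose A := (fun y : 'rV[R]_p.+1 => y 0 j) @` (S `&` col' j @^-1` ~` U).
  have cA : compact A.
    apply: continuous_compact.
      by apply: continuous_subspaceT => y; exact: coord_continuous.
    apply: compact_closedI => //.
    by apply: closed_comp; [move=> y _; exact: ccol|exact: open_closedC].
  have clA : closed A by apply: compact_closed cA; exact: Rhausdorff.
  have nA : ~ A t.
    move=> [y [Sy nUy] yt]; apply: nUy; apply: SU; exists y => //.
  have : nbhs t (~` A) by apply: open_nbhs_nbhs; split=> //; exact: closed_openC.
  apply: filterS => t' nAt' y Sy yt'; apply: contrapT => nU; apply: nAt'.
  by exists y.
pose P n t' := exists U, covered nat U eps /\
  forall y, S y -> `|y 0 j - t'| <= (2 * M) / n.+1%:R -> U (col' j y).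
have [n _ Pn] : \forall n \near \oo, [set` `[- M, M]] `<=` P n.
  apply: (iffLR (compact_near_coveringP _) (@segment_compact R (- M) M)) => t _.
  have [U [CU /nbhs_ballP[d /= d0 Hd]]] := loc t.
  pose m := Num.truncn (2 * M / (d / 2)).
  exists (ball t (d / 2), [set n | (m <= n)%N]).
    split=> /=; first by apply: nbhsx_ballx; rewrite divr_gt0.
    by exists m.
  move=> [t' n] [/= tt' mn]; exists U; split=> // y Sy yt'.
  apply: Hd (erefl _) => //; rewrite -ball_normE /=.
  have : 2 * M / n.+1%:R < d / 2.
    rewrite ltr_pdivrMr// [ltRHS]mulrC -ltr_pdivrMr ?divr_gt0//.
    apply: (lt_le_trans (truncnS_gt _)).
    by rewrite ler_nat ltnS.
  move: tt'; rewrite -ball_normE /= => tt' h.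
  have -> : t - y 0 j = (t - t') + (t' - y 0 j) by rewrite addrA subrK.
  rewrite (le_lt_trans (ler_normD _ _))// [ltRHS]splitr ltrD//.
  by rewrite distrC; exact: le_lt_trans yt' h.
pose s i : R := - M + (2 * M) / n.+1%:R * i%:R.
have n0 : 0 < 2 * M / n.+1%:R by rewrite divr_gt0// mulr_gt0.
have sM i : (i <= n.+1)%N -> - M <= s i <= M.
  move=> i_n; rewrite /s lerDl mulr_ge0 ?(ltW n0)//=.
  rewrite -lerBrDl opprK mulrAC ler_pdivrMr//.
  have : i%:R <= n.+1%:R :> R by rewrite ler_nat.
  nra.
have {}Pn i : (i <= n.+1)%N -> P n (s i).
  by move=> /sM si; apply: (Pn n) => /=; rewrite ?in_itv.
pose U i := if pselect (P n (s i)) is left h then projT1 (cid h) else set0.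
have HU i : (i <= n.+1)%N -> covered nat (U i) eps /\
    forall y, S y -> `|y 0 j - s i| <= (2 * M) / n.+1%:R -> U i (col' j y).
  by move=> /Pn h; rewrite /U; case: pselect => // h'; case: cid.
have -> : e = n.+1%:R * ((2 * M / n.+1%:R) * eps).
  by rewrite /eps; field; rewrite lt0r_neq0// nat1r pnatr_eq0.
have cov i : (i < n.+1)%N -> covered nat
   [set y : 'rV[R]_p.+1 | s i <= y 0 j <= s i.+1 /\ U i (col' j y)] ((2 * M / n.+1%:R) * eps).
  move=> i_n.
  have -> : 2 * M / n.+1%:R = s i.+1 - s i by rewrite /s -[i.+1]addn1 natrD; ring.
  apply: covered_slab; last exact: (HU i (ltnW i_n)).1.
  by rewrite /s lerD2l ler_wpM2l ?(ltW n0)// ler_nat.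
apply: coveredS (covered_bigcup_ord _ cov); last by rewrite mulr_ge0 ?ltW.
move=> y Sy.
have yM : - M <= y 0 j <= M.
  by rewrite -ler_norml (le_trans (ler_coord_norm _ _ _)) ?SM.
pose q := (y 0 j + M) / (2 * M / n.+1%:R).
have q0 : 0 <= q by rewrite divr_ge0 ?(ltW n0)//; lra.
have /andP[q1 q2] := truncn_itv q0; set i0 := Num.truncn q in q1 q2.
have key i : i%:R <= q <= i.+1%:R -> (i < n.+1)%N ->
  (\bigcup_(i in [set i | (i < n.+1)%N])
   [set y : 'rV[R]_p.+1 | s i <= y 0 j <= s i.+1 /\ U i (col' j y)]) y.
  move=> /andP[iq qi] i_n; exists i => //=.
  have yE : y 0 j = - M + (2 * M) / n.+1%:R * q.
    by rewrite /q; field; rewrite lt0r_neq0//= lt0r_neq0.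
  have b1 : s i <= y 0 j by rewrite yE lerD2l ler_wpM2l// ltW.
  have b2 : y 0 j <= s i.+1 by rewrite yE lerD2l ler_wpM2l// ltW.
  split; first by rewrite b1 b2.
  apply: (HU i (ltnW i_n)).2 => //; rewrite ger0_norm ?subr_ge0//.
  have E : s i.+1 = s i + 2 * M / n.+1%:R by rewrite /s -[i.+1]addn1 natrD; ring.
  by rewrite lerBlDl -E.
have [lt_i0|ge_i0] := ltnP i0 n.+1; first by apply: key lt_i0; rewrite q1 ltW.
apply: (key n) => //.
have qn : q <= n.+1%:R.
  rewrite /q ler_pdivrMr// mulrCA divff// mulr1; lra.
rewrite qn andbT (le_trans _ q1)// ler_nat; exact: ltnW.
Qed.

Lemma null_of_finite_covers n (S : set 'rV[R]_n) :
  (forall e, 0 < e -> exists (I : finType) (a b : I -> 'rV[R]_n),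
    [/\ forall t i, a t 0 i <= b t 0 i, S `<=` \bigcup_t box (a t) (b t) &
        \sum_t vol (a t) (b t) <= e]) ->
  lebesgue_null S.
Proof.
move=> H; apply/nullP => e /H[I [a [b [ab Sab v]]]].
apply: (@covered_nat I); exists setT, a, b; split=> //.
rewrite esum_fset; last 2 first.
- exact: finite_finset.
- by move=> t _; rewrite lee_fin vol_ge0.
rewrite (fsbigE (index_enum I)) ?index_enum_uniq//; last first.
  by move=> t _; rewrite mem_index_enum.
rewrite (eq_bigl xpredT) => [|t]; last by rewrite in_setT.
by rewrite sumEFin lee_fin.
Qed.

Lemma rV_second_countable n : @second_countable 'rV[R]_n.
Proof.
pose Bs := [set V : set 'rV[R]_n | exists p : 'rV[rat]_n * nat,
  V = ball (map_mx ratr p.1 : 'rV[R]_n) (p.2.+1%:R^-1)].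
exists Bs.
  have -> : Bs = range (fun p : 'rV[rat]_n * nat =>
      ball (map_mx ratr p.1 : 'rV[R]_n) (p.2.+1%:R^-1)).
    by apply/seteqP; split=> V [p]; [move=> ->; exists p|move=> _ <-; exists p].
  exact: sub_countable (card_image_le _ _) (countableP _).
split=> [_ [p ->]|x P]; first exact: ball_open.
move=> /nbhs_ballP[e /= e0 eP].
pose m := Num.truncn (2 / e).
have me : m.+1%:R^-1 < e / 2.
  rewrite -[ltRHS]invrK ltf_pV2 ?posrE// ?invr_gt0 ?divr_gt0//.
  by rewrite invf_div; exact: truncnS_gt.
have m0 : 0 < m.+1%:R^-1 :> R by rewrite invr_gt0.
have /choice[q Hq] (i : 'I_n) : exists q : rat, `|x 0 i - ratr q| < m.+1%:R^-1.
  have [|q] := @rat_in_itvoo R (x 0 i - m.+1%:R^-1) (x 0 i + m.+1%:R^-1).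
    by rewrite ltrD2l gtrN.
  rewrite in_itv /= => /andP[q1 q2]; exists q; rewrite ltr_norml.
  by move: (m.+1%:R^-1) q1 q2 => d q1 q2; apply/andP; split; lra.
have xq : ball (map_mx ratr (\row_i q i) : 'rV[R]_n) m.+1%:R^-1 x.
  by split=> // i j; rewrite !mxE (ord1 i) /ball /= distrC.
exists (ball (map_mx ratr (\row_i q i) : 'rV[R]_n) m.+1%:R^-1).
  by split=> //; exists (\row_i q i, m).
move=> y qy; apply: eP; apply: (@le_ball _ _ _ (m.+1%:R^-1 + m.+1%:R^-1)).
  by rewrite (le_trans (lerD (ltW me) (ltW me)))// -splitr.
by apply: ball_triangle qy; exact: ball_sym.
Qed.

End NullSets.

(** * Matrices with independent columns *)

Section FullColumnRank.
Variable F : fieldType.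

Lemma row_full_ker m n (A : 'M[F]_(m, n)) (v : 'cV[F]_n) :
  row_full A -> A *m v = 0 -> v = 0.
Proof.
by move=> /row_fullP[B BA] Av; rewrite -[v]mul1mx -BA -mulmxA Av mulmx0.
Qed.

Lemma row_full_of_ker m n (A : 'M[F]_(m, n)) :
  (forall v : 'cV[F]_n, A *m v = 0 -> v = 0) -> row_full A.
Proof.
move=> H; rewrite -[A]trmxK /row_full mxrank_tr -/(row_free A^T) -kermx_eq0.
apply/eqP/row_matrixP => i; rewrite row0; apply: (can_inj (@trmxK _ _ _)).
rewrite trmx0; apply: H; apply: (can_inj (@trmxK _ _ _)).
by rewrite trmx_mul trmxK trmx0 -row_mul mulmx_ker row0.
Qed.

Lemma row_full_add m n (A : 'M[F]_(m, n)) (u : 'cV[F]_m) :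
  row_full A -> ~ (exists c, u = A *m c) -> row_full (row_mx A u).
Proof.
move=> fA nu; apply: row_full_of_ker => w; rewrite -[w]vsubmxK mul_row_col => E.
set v := usubmx w in E *; set t := dsubmx w in E *.
have t0 : t = 0.
  apply/eqP; apply: contrapT => tn; apply: nu.
  have t00 : t 0 0 != 0.
    apply/eqP => t00; apply: tn; apply/eqP.
    by rewrite [t]mx11_scalar t00 raddf0.
  exists (- (t 0 0)^-1 *: v); rewrite -scalemxAr.
  have -> : A *m v = - (t 0 0 *: u).
    by apply: (addIr (t 0 0 *: u)); rewrite addNr -mul_mx_scalar -mx11_scalar.
  by rewrite scalerN scaleNr opprK scalerA mulVf// scale1r.
have v0 : v = 0 by apply: (row_full_ker fA); rewrite -E t0 mulmx0 addr0.
by rewrite v0 t0 col_mx0.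
Qed.

Lemma row_full_rowl m n p (A : 'M[F]_(m, n)) (D : 'M[F]_(m, p)) :
  row_full (row_mx A D) -> row_full A.
Proof.
move=> f; apply: row_full_of_ker => v Av.
have := @row_full_ker _ _ _ (col_mx v 0) f.
rewrite mul_row_col Av mulmx0 addr0 => /(_ erefl) /(congr1 usubmx).
by rewrite col_mxKu raddf0.
Qed.

Lemma row_full0 m n (A : 'M[F]_(m, n)) (D : 'M[F]_(m, 0)) :
  row_full A -> row_full (row_mx A D).
Proof.
move=> f; apply: row_full_of_ker => w; rewrite -[w]vsubmxK mul_row_col.
rewrite [dsubmx w]flatmx0 mulmx0 addr0 => /(row_full_ker f) ->.
by rewrite col_mx0.
Qed.

(** Both matrices have the same columns up to order; a relation between the
    columns of one is a relation between those of the other. *)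
Lemma row_full_col' m n p (A : 'M[F]_(m, n)) (D : 'M[F]_(m, p.+1)) j :
  row_full (row_mx (row_mx A (col j D)) (col' j D)) -> row_full (row_mx A D).
Proof.
move=> f; apply: row_full_of_ker => w; rewrite -[w]vsubmxK mul_row_col => E.
set v := usubmx w in E *; set e := dsubmx w in E *.
have De : D *m e = col j D *m row j e + col' j D *m row' j e.
  apply/matrixP => a b; rewrite !mxE (bigD1_ord j)//= big_ord1 !mxE; congr (_ + _).
  by apply: eq_bigr => i _; rewrite !mxE.
have := @row_full_ker _ _ _ (col_mx (col_mx v (row j e)) (row' j e)) f.
rewrite !mul_row_col -addrA -De E => /(_ erefl) z.
have /= z1 := congr1 usubmx z; have /= z2 := congr1 dsubmx z.
rewrite col_mxKu raddf0 in z1; rewrite col_mxKd raddf0 in z2.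
have /= z3 := congr1 usubmx z1; have /= z4 := congr1 dsubmx z1.
rewrite col_mxKu raddf0 in z3; rewrite col_mxKd raddf0 in z4.
rewrite z3; suff -> : e = 0 by rewrite col_mx0.
apply/matrixP => a b; have [i|] := unliftP j a => ->.
  by have /matrixP/(_ i b) := z2; rewrite !mxE.
by have /matrixP/(_ 0 b) := z4; rewrite !mxE.
Qed.

(** The relation [col j D = A *m c] survives any insertion of columns. *)
Lemma row_full_span m n q p (A : 'M[F]_(m, n)) (E : 'M[F]_(m, q)) (D : 'M[F]_(m, p)) j
    (c : 'cV[F]_n) :
  col j D = A *m c -> ~~ row_full (row_mx (row_mx A E) D).
Proof.
move=> Dc; apply/negP => f.
have := @row_full_ker _ _ _ (col_mx (col_mx c 0) (- delta_mx j 0)) f.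
rewrite !mul_row_col mulmx0 addr0 mulmxN -colE Dc subrr => /(_ erefl) /(congr1 dsubmx).
rewrite col_mxKd raddf0 => /matrixP/(_ j 0); rewrite !mxE !eqxx /= => /eqP.
by rewrite oppr_eq0 oner_eq0.
Qed.

End FullColumnRank.

(** * Images of small cubes *)

Section SardAux.
Variable R : realType.

Lemma near_row_full N q (O : set 'rV[R]_N) (M : 'rV[R]_N -> 'M[R]_(N, q)) x :
  open O -> O x -> smooth_mx O M -> row_full (M x) ->
  \forall y \near x, row_full (M y).
Proof.
move=> oO Ox sM /row_fullP[B BM].
have sBM : smooth_mx O (fun y => B *m M y).
  by apply: smooth_mulmx => //; exact: smooth_mx_cst.
have /cvgrPdist_lt/(_ 1 ltr01) := smooth_continuous (smooth_det oO sBM) Ox.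
apply: filterS => y; rewrite BM det1 => h.
apply/row_fullP; exists (invmx (B *m M y) *m B); rewrite -mulmxA mulVmx//.
rewrite unitmxE unitfE; apply/eqP => d0.
by rewrite d0 subr0 normr1 ltxx in h.
Qed.

Lemma smooth_row_mx N a b c (O : set 'rV[R]_N) (M : 'rV[R]_N -> 'M[R]_(a, b))
    (M' : 'rV[R]_N -> 'M[R]_(a, c)) : open O ->
  smooth_mx O M -> smooth_mx O M' -> smooth_mx O (fun x => row_mx (M x) (M' x)).
Proof.
move=> oO s s' i j; case: (splitP j) => j' jj.
  apply: smooth_ext (s i j') => // x _.
  by rewrite (_ : j = lshift c j') ?row_mxEl//; exact: val_inj.
apply: smooth_ext (s' i j') => // x _.
by rewrite (_ : j = rshift b j') ?row_mxEr//; exact: val_inj.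
Qed.

Lemma Jac_row_mx N b c (G : 'rV[R]_N -> 'rV[R]_b) (H : 'rV[R]_N -> 'rV[R]_c) x :
  Jac (fun y => row_mx (G y) (H y)) x = row_mx (Jac G x) (Jac H x).
Proof.
apply/matrixP => i j; rewrite !mxE; case: (split_ordP j) => j' ->;
  by rewrite mxE; congr ('D_ _ _ _); apply/funext => y; rewrite ?row_mxEl ?row_mxEr.
Qed.

Lemma Jac_scalar N (phi : 'rV[R]_N -> R) x :
  Jac (fun y => (phi y)%:M : 'rV[R]_1) x = grad phi x.
Proof.
apply/matrixP => i j; rewrite !mxE (ord1 j).
by congr ('D_ _ _ _); apply/funext => y; rewrite mxE eqxx mulr1n.
Qed.

Lemma Jac_col' N p j (f : 'rV[R]_N -> 'rV[R]_p.+1) x :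
  Jac (fun y => col' j (f y)) x = col' j (Jac f x).
Proof.
apply/matrixP => i l; rewrite !mxE.
by congr ('D_ _ _ _); apply/funext => y; rewrite mxE.
Qed.

(** About [n ^ N] cubes of side [2 s / n] cover [S]. The image of each is at most
    [2 C (2 s / n) ^ N.+1] thick in the first coordinate and bounded in the
    others, so that the total volume is [O(1 / n)]. *)
Lemma null_cubes N p (S : set 'rV[R]_N) (f : 'rV[R]_N -> 'rV[R]_p.+1) x0 s C M :
  0 <= s -> 0 <= C -> 0 <= M -> S `<=` cball x0 s -> (forall x, S x -> `|f x| <= M) ->
  (forall x y, S x -> S y -> `|f y 0 0 - f x 0 0| <= C * `|y - x| ^+ N.+1) ->
  lebesgue_null (f @` S).
Proof.
move=> s0 C0 M0 Ss SM SC; apply: null_of_finite_covers => e e0.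
pose D := (2 * (C * (2 * s) ^+ N.+1)) * (2 * M) ^+ p.
have D0 : 0 <= D by rewrite !mulr_ge0 ?exprn_ge0 ?mulr_ge0.
pose n := Num.truncn (D / e); pose del := 2 * s / n.+1%:R.
have Dn : D / n.+1%:R <= e.
  rewrite ler_pdivrMr// mulrC -ler_pdivrMr//; exact/ltW/truncnS_gt.
have del0 : 0 <= del by rewrite divr_ge0// mulr_ge0.
pose cube (g : {ffun 'I_N -> 'I_n.+1}) : set 'rV[R]_N :=
  [set x | forall i, del * (g i)%:R <= x 0 i - x0 0 i + s <= del * (g i).+1%:R].
have diam g x y : cube g x -> cube g y -> `|y - x| <= del.
  move=> gx gy; apply: rV_norm_le => // i; rewrite !mxE.
  have := gx i; have := gy i; rewrite -[(g i).+1]addn1 natrD mulrDr mulr1.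
  move: (del * _) => z /andP[h1 h2] /andP[h3 h4]; rewrite ler_norml.
  by apply/andP; split; lra.
have inc x : S x -> exists g, cube g x.
  move=> Sx; have /choice[g Hg] (i : 'I_N) : exists t : 'I_n.+1,
      del * t%:R <= x 0 i - x0 0 i + s <= del * t.+1%:R.
    have xs : `|x 0 i - x0 0 i| <= s.
      by have := Ss x Sx; apply: le_trans; have := ler_coord_norm (x - x0) 0 i; rewrite !mxE.
    set w := x 0 i - x0 0 i + s.
    have /andP[w0 w1] : 0 <= w <= 2 * s.
      by move: xs; rewrite ler_norml /w => /andP[h1 h2]; apply/andP; split; lra.
    have [d0|dn] := eqVneq del 0.
      have sz : s = 0.
        by move/eqP: d0; rewrite mulf_eq0 invr_eq0 pnatr_eq0 orbF mulf_eq0 pnatr_eq0 => /eqP.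
      exists ord0; rewrite d0 !mul0r; apply/andP; split => //.
      by move: w1; rewrite sz mulr0.
    have dp : 0 < del by rewrite lt_def dn.
    pose q := w / del; have q0 : 0 <= q by rewrite divr_ge0.
    have /andP[q1 q2] := truncn_itv q0; set i0 := Num.truncn q in q1 q2.
    have wq : w = del * q by rewrite /q mulrC divfK.
    have [lt_i0|ge_i0] := ltnP i0 n.+1.
      by exists (Ordinal lt_i0); rewrite /= wq !ler_pM2l// q1 ltW.
    exists ord_max; rewrite /= wq ler_pM2l//; apply/andP; split.
      by apply: le_trans q1; rewrite ler_nat ltnW.
    by rewrite -wq /del divfK.
  by exists [ffun i => g i] => i; rewrite ffunE; exact: Hg.
pose w := C * del ^+ N.+1; have w0 : 0 <= w by rewrite mulr_ge0 ?exprn_ge0.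
(* Any point will do for a cube that misses [S]: its box only adds to the volume. *)
have /choice[c Hc] (g : {ffun 'I_N -> 'I_n.+1}) : exists c : 'rV[R]_N,
    (exists x, (S `&` cube g) x) -> (S `&` cube g) c.
  by have [[x Sx]|nx] := pselect (exists x, (S `&` cube g) x); [exists x|exists 0].
pose a g : 'rV[R]_p.+1 := \row_i (if i == 0 then f (c g) 0 0 - w else - M).
pose b g : 'rV[R]_p.+1 := \row_i (if i == 0 then f (c g) 0 0 + w else M).
exists {ffun 'I_N -> 'I_n.+1}, a, b; split.
- by move=> g i; rewrite !mxE; case: ifP => _; lra.
- move=> _ [x Sx <-]; have [g gx] := inc x Sx; exists g => // i; rewrite !mxE.
  have [Sc gc] : (S `&` cube g) (c g) by apply: Hc; exists x.
  case: ifP => [/eqP ->|_]; last first.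
    by rewrite -ler_norml (le_trans (ler_coord_norm _ _ _))// SM.
  have : `|f x 0 0 - f (c g) 0 0| <= w.
    apply: le_trans (SC _ _ Sc Sx) _; rewrite ler_wpM2l// lerXn2r ?nnegrE//.
    exact: diam gc gx.
  by rewrite ler_norml => /andP[h1 h2]; apply/andP; split; lra.
have volE g : vol (a g) (b g) = 2 * w * (2 * M) ^+ p.
  rewrite /vol big_ord_recl !mxE eqxx; congr (_ * _); first by ring.
  rewrite (eq_bigr (fun=> 2 * M)) ?prodr_const ?card_ord// => i _.
  by rewrite !mxE /=; ring.
rewrite (eq_bigr _ (fun g _ => volE g)) sumr_const card_ffun !card_ord.
apply: le_trans Dn; rewrite -[leLHS]mulr_natl natrX le_eqVlt; apply/orP; left; apply/eqP.
rewrite /w /del /D expr_div_n; have n0 : n.+1%:R != 0 :> R by rewrite pnatr_eq0.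
rewrite (exprS n.+1%:R N); have z0 := expf_neq0 N n0.
move: z0 n0; set y : R := n.+1%:R; set z := y ^+ N => z0 y0.
by clearbody z; clearbody y; field; rewrite y0 z0.
Qed.

End SardAux.

(** * Sard's theorem on level sets *)

Section Sard.
Variable R : realType.

(** The critical points of [f] restricted to the level set [G = 0]. At a point
    where the columns of [Jac G] are independent, the derivative of [f] along the
    level set is onto exactly if no relation links the columns of [Jac G] and
    [Jac f]. *)
Definition crit N k p (O : set 'rV[R]_N) (G : 'rV[R]_N -> 'rV[R]_k)
    (f : 'rV[R]_N -> 'rV[R]_p) : set 'rV[R]_N :=
  [set x | [/\ O x, G x = 0, row_full (Jac G x) &
               ~~ row_full (row_mx (Jac G x) (Jac f x))]].

(** A function which vanishes at [x] can be added to the equations of the level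
    set. If some component of [f] has zero derivative along the level set, then
    it still has on the smaller one, and [x] remains critical. *)
Lemma crit_add N k p (O : set 'rV[R]_N) (G : 'rV[R]_N -> 'rV[R]_k)
    (f : 'rV[R]_N -> 'rV[R]_p.+1) (psi : 'rV[R]_N -> R) j x c :
  crit O G f x -> psi x = 0 -> row_full (row_mx (Jac G x) (grad psi x)) ->
  grad (fun y => f y 0 j) x = Jac G x *m c ->
  crit O (fun y => row_mx (G y) (psi y)%:M) f x.
Proof.
move=> [Ox Gx _ _] px full fc; split=> //.
- by rewrite Gx px raddf0 row_mx0.
- by rewrite Jac_row_mx Jac_scalar.
rewrite Jac_row_mx; apply: (@row_full_span _ _ _ _ _ _ _ _ j c).
by rewrite col_Jac.
Qed.

(** On the hypersurface [f_j = t] of the level set, the remaining components of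
    [f] have to be critical, because [f_j] is not. *)
Lemma crit_slice N k p (O : set 'rV[R]_N) (G : 'rV[R]_N -> 'rV[R]_k)
    (f : 'rV[R]_N -> 'rV[R]_p.+1) j t x : open O -> smooth_mx O f ->
  crit O G f x -> f x 0 j = t -> row_full (row_mx (Jac G x) (col j (Jac f x))) ->
  crit O (fun y => row_mx (G y) (f y 0 j - t)%:M) (fun y => col' j (f y)) x.
Proof.
move=> oO sf [Ox Gx fG nfull] ft full.
have gE : grad (fun y => f y 0 j - t) x = col j (Jac f x).
  apply/colP => i; rewrite !mxE.
  have d : differentiable (fun y => f y 0 j) x by exact: smooth_differentiable (sf 0 j) Ox.
  rewrite deriveB ?derive_cst ?subr0//; exact: diff_derivable.
split=> //.
- by rewrite Gx ft subrr raddf0 row_mx0.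
- by rewrite Jac_row_mx Jac_scalar gE.
by apply: contra nfull; rewrite Jac_row_mx Jac_scalar gE Jac_col'; exact: row_full_col'.
Qed.

Section Step.
Variables (N k p : nat) (O : set 'rV[R]_N) (G : 'rV[R]_N -> 'rV[R]_k)
  (f : 'rV[R]_N -> 'rV[R]_p.+1).
Hypotheses (oO : open O) (sG : smooth_mx O G) (sf : smooth_mx O f).
Hypothesis IH : forall q (G' : 'rV[R]_N -> 'rV[R]_(k + 1)) (f' : 'rV[R]_N -> 'rV[R]_q),
  smooth_mx O G' -> smooth_mx O f' -> lebesgue_null (f' @` crit O G' f').

Let spanned j x := exists c, grad (fun y => f y 0 j) x = Jac G x *m c.

(** Where the component [f_j] has a nonzero derivative along the level set, the
    critical values are sliced by [f_j = t]. The slices consist of critical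
    values on level sets of smaller dimension, and [null_fubini] applies since
    nearby critical points form a compact set. *)
Lemma null_crit_transversal j x0 : crit O G f x0 -> ~ spanned j x0 ->
  exists2 V, nbhs x0 V & lebesgue_null (f @` (crit O G f `&` V)).
Proof.
move=> [Ox0 _ fG0 _] ns.
pose M x := row_mx (Jac G x) (col j (Jac f x)).
have sM : smooth_mx O M.
  apply: smooth_row_mx => //; first exact: smooth_Jac.
  move=> a b; apply: smooth_ext (smooth_Jac oO sf a j) => // x _.
  by rewrite [RHS]mxE.
have fM0 : row_full (M x0).
  by apply: row_full_add => // -[c]; rewrite col_Jac => E; apply: ns; exists c.
have [r r0 Hr] : exists2 r, 0 < r & cball x0 r `<=` [set y | O y /\ row_full (M y)].
  apply: nbhs_cball; apply: filterI; first exact: open_nbhs_nbhs.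
  exact: near_row_full oO Ox0 sM fM0.
exists (cball x0 r); first exact: cball_nbhs.
have rO : cball x0 r `<=` O by move=> y /Hr[].
pose E := crit O G f `&` cball x0 r.
have cE : compact E.
  have -> : E = cball x0 r `&` [set x | ~ (O x /\
      (G x <> 0 \/ row_full (row_mx (Jac G x) (Jac f x))))].
    apply/seteqP; split=> x.
      move=> [[Ox Gx _ nf] xr]; split=> // -[_ [//|]]; exact/negP.
    move=> [xr H]; have [Ox /row_full_rowl fG] := Hr x xr; split=> //; split=> //.
      by apply: contrapT => nG; apply: H; split=> //; left.
    by apply/negP => full; apply: H; split=> //; right.
  apply: compact_closedI; first exact: cball_compact.
  rewrite -[X in closed X]/(~` _); apply: open_closedC; rewrite openE => x [Ox Hx].
  have nO : nbhs x O by exact: open_nbhs_nbhs.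
  case: Hx => [/eqP Gx|full].
    have [l Gl] : exists l, G x 0 l != 0.
      by apply/existsP; apply: contraNT Gx => /existsPn H; apply/eqP/rowP => l;
        have /negPn/eqP -> := H l; rewrite mxE.
    have := smooth_continuous (sG 0 l) Ox.
    move=> /cvgrPdist_lt/(_ `|G x 0 l|); rewrite normr_gt0 => /(_ Gl) h.
    apply: filterS2 nO h => y Oy h; split=> //; left => Gy.
    by move: h; rewrite Gy mxE subr0 ltxx.
  have sJ : smooth_mx O (fun x => row_mx (Jac G x) (Jac f x)).
    by apply: smooth_row_mx => //; exact: smooth_Jac.
  have := near_row_full oO Ox sJ full.
  by apply: filterS2 nO => y Oy h; split=> //; right.
apply: (@null_fubini _ _ j).
  apply: continuous_compact => //; apply: continuous_in_subspaceT => y /[!inE] -[[Oy _ _ _] _].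
  exact/differentiable_continuous/(smooth_mx_differentiable sf).
move=> t.
have sG' : smooth_mx O (fun y => row_mx (G y) (f y 0 j - t)%:M).
  apply: smooth_row_mx => // a b; rewrite (ord1 a) (ord1 b).
  have : smooth O (fun y => f y 0 j - t) by apply: smoothB => //; exact: smooth_cst.
  by apply: smooth_ext => // y _; rewrite mxE eqxx mulr1n.
have sf' : smooth_mx O (fun y => col' j (f y)).
  by move=> a b; apply: smooth_ext (sf a (lift j b)) => // y _; rewrite mxE.
apply: nullS (IH sG' sf') => _ [_ [[x [Cx xr] <-] /= ft] <-].
exists x => //; apply: crit_slice => //.
by have [] := Hr x xr.
Qed.

Let crit_spanned := [set x | crit O G f x /\ forall j, spanned j x].

(** At a point where [flat] fails, some iterated tangential derivative of [psi]
    vanishes while one of its tangential derivatives does not; it is added to the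
    equations of the level set. *)
Lemma null_crit_nonflat B K psi : smooth O psi ->
  lebesgue_null (f @` [set x | [/\ crit_spanned x, psi x = 0 & ~ flat G B K psi x]]).
Proof.
elim: K psi => [|K IHK] psi spsi.
  by apply: nullS (@null_set0 R _) => _ [x [_ _ []]].
have sG' : smooth_mx O (fun y => row_mx (G y) (psi y)%:M).
  apply: smooth_row_mx => // a b; rewrite (ord1 a) (ord1 b).
  by apply: smooth_ext spsi => // y _; rewrite mxE eqxx mulr1n.
apply: nullS (null_setU (IH sG' sf) (null_bigcup (fun i => IHK _ (smooth_tang B oO sG i spsi)))).
move=> _ [x [Cx px nflat] <-]; have /existsNP[i] := nflat.
move=> /not_andP; have [t0|tn] := eqVneq (tang G B i psi x) 0.
  by move=> [//|nf]; right; exists i => //; exists x.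
move=> _; left; exists x => //; case: (Cx) => Cr /(_ ord0) [c fc].
apply: (crit_add Cr px _ fc); apply: row_full_add; first by case: Cr.
by move=> [c' E]; move/eqP: tn; apply; rewrite /tang (tangD_span B E) mxE.
Qed.

(** Near [x0], either some tangential derivative of the first component [phi] of
    [f], of order at most [N], is nonzero, and [null_crit_nonflat] applies, or
    [flat_estimate] gives the bound which [null_cubes] requires. *)
Lemma null_crit_tangential x0 : crit_spanned x0 ->
  exists2 V, nbhs x0 V & lebesgue_null (f @` (crit_spanned `&` V)).
Proof.
move=> [[Ox0 Gx0 fG0 _] _]; have [B BG] := row_fullP fG0.
have [r r0 good] := exists_regular_ball oO sG Ox0 BG.
have [s [L [rho [s0 L0 rhoP rhoK rhoL]]]] := level_set_retraction oO sG Ox0 Gx0 r0 good.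
have rO : cball x0 r `<=` O by move=> y /good[].
exists (cball x0 s); first exact: cball_nbhs.
pose phi y := f y 0 0.
have sphi : smooth O phi by exact: sf.
have [C C0 HC] := flat_estimate oO sG good L0 rhoP rhoL N sphi.
have [M M0 HM] := smooth_mx_bounded rO sf.
pose E := [set x | [/\ crit_spanned x, cball x0 s x & flat G B N phi x]].
have nE : lebesgue_null (f @` E).
  apply: (@null_cubes _ _ _ _ _ x0 s C M) => //; first exact: ltW.
  - by move=> x [].
  - move=> x [[[_ Gx _ _] _] xs _]; apply: HM.
    by rewrite -(rhoK x xs Gx); have [] := rhoP x xs.
  move=> x y [[[_ Gx _ _] _] xs fx] [[[_ Gy _ _] _] ys _].
  by have := HC x y xs ys; rewrite (rhoK x)// (rhoK y)//; exact.
have nF i K : lebesgue_null (f @` [set x |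
    [/\ crit_spanned x, tang G B i phi x = 0 & ~ flat G B K (tang G B i phi) x]]).
  by apply: null_crit_nonflat; exact: smooth_tang.
apply: nullS (null_setU nE (null_bigcup (fun iK : 'I_N * nat => nF iK.1 iK.2))).
move=> _ [x [Cx xs] <-].
have [fl|nfl] := pselect (flat G B N phi x); first by left; exists x.
have nonflat K : ~ flat G B K phi x -> exists i K',
    ~ (tang G B i phi x = 0 /\ flat G B K' (tang G B i phi) x).
  case: K => [|K]; first by case.
  by move=> /existsNP[i H]; exists i, K.
have [i [K]] := nonflat _ nfl.
have [_ /(_ ord0) [c fc]] := Cx.
have t0 : tang G B i phi x = 0 by rewrite /tang (tangD_span B fc) mxE.
by move=> /not_andP[//|nfl2]; right; exists (i, K) => //; exists x.
Qed.

Lemma null_crit_step : lebesgue_null (f @` crit O G f).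
Proof.
pose crit_unspanned := [set x | crit O G f x /\ exists j, ~ spanned j x].
have -> : crit O G f = crit_unspanned `|` crit_spanned.
  apply/seteqP; split=> [x Cx|x [[]|[]]//].
  have [H|/existsNP H] := pselect (forall j, spanned j x); first by right.
  by left.
rewrite image_setU; apply: null_setU; apply: (@null_of_locally R 'rV[R]_N).
- exact: rV_second_countable.
- move=> x [Cx [j ns]]; have [V Vx HV] := null_crit_transversal Cx ns.
  exists V => //; apply: nullS HV; apply: image_subset; by apply: setSI => y [].
- exact: rV_second_countable.
- by move=> x; exact: null_crit_tangential.
Qed.

End Step.

(** The induction is on the dimension [N - k] of the level set, for all [p]: each
    step adds one equation to [G]. *)
Theorem sard N k p (O : set 'rV[R]_N) (G : 'rV[R]_N -> 'rV[R]_k)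
    (f : 'rV[R]_N -> 'rV[R]_p) :
  open O -> smooth_mx O G -> smooth_mx O f -> lebesgue_null (f @` crit O G f).
Proof.
move=> oO; have [d] := ubnP (N.+1 - k); elim: d k p G f => // d IH k p G f.
rewrite ltnS => Nkd sG sf.
have [kN|Nk] := leqP k N; last first.
  apply: nullS (@null_set0 R _) => y [x [_ _ fG _] _].
  by move: fG; rewrite /row_full => /eqP rk; have := rank_leq_row (Jac G x); rewrite rk leqNgt Nk.
case: p f sf => [|p] f sf.
  apply: nullS (@null_set0 R _) => y [x [_ _ fG /negP nf] _].
  by apply: nf; exact: row_full0.
apply: null_crit_step => // q G' f' sG' sf'; apply: IH => //.
by rewrite addn1 subSS; apply: leq_trans Nkd; rewrite subSn.
Qed.

End Sard.

(** * Ranks relative to a coordinate subspace *)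

Section RankLemmas.
Variable F : fieldType.

(** Modulo the first [s] coordinates, [A] is [A *m copid_mx s], whose rows are
    independent from the coordinate subspace. *)
Lemma rank_add_pid m n s (A : 'M[F]_(m, n)) : (s <= n)%N ->
  \rank (A + (pid_mx s : 'M[F]_n))%MS = (\rank (A *m copid_mx s) + s)%N.
Proof.
move=> sn; set P : 'M[F]_n := pid_mx s; set C : 'M[F]_n := copid_mx s.
have PP : P *m P = P by exact: pid_mx_id.
have PC : P *m C = 0 by exact: mul_pid_mx_copid.
have CE : C = 1%:M - P by [].
have E : (A + P :=: A *m C + P)%MS.
  apply/eqmxP/andP; split; rewrite addsmx_sub addsmxSr andbT.
    have -> : A = A *m C + A *m P by rewrite -mulmxDr CE subrK mulmx1.
    apply: submx_trans (addmx_sub_adds (submx_refl _) (submxMl _ _)) _.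
    by rewrite -mulmxDr CE subrK mulmx1 submx_refl.
  rewrite CE mulmxBr mulmx1; apply: addmx_sub; first exact: addsmxSl.
  by rewrite eqmx_opp; apply: submx_trans (submxMl _ _) (addsmxSr _ _).
rewrite E mxrank_disjoint_sum ?rank_pid_mx//.
apply/eqP/rowV0P => v; rewrite sub_capmx => /andP[/submxP[w vw] /submxP[u vu]].
have vP : v *m P = v by rewrite {1}vu -mulmxA PP -vu.
have CP : C *m P = 0 by exact: mul_copid_mx_pid.
by rewrite -vP vw -!mulmxA CP !mulmx0.
Qed.

Lemma row_full_colsub m n (A : 'M[F]_(m, n)) :
  exists g : {ffun 'I_(\rank A) -> 'I_n}, row_full (colsub g A).
Proof.
pose h := maxrankfun A^T; have e : \rank A^T = \rank A by exact: mxrank_tr.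
exists [ffun i => h (cast_ord (esym e) i)].
have := maxrowsub_free A^T; rewrite /row_free => /eqP rk.
rewrite /row_full -mxrank_tr; apply/eqP; rewrite -[RHS]e -[RHS]rk.
suff : ((colsub [ffun i => h (cast_ord (esym e) i)] A)^T :=: rowsub h A^T)%MS by move=> ->.
apply/eqmxP/andP; split; apply/row_subP => i.
  have -> : row i (colsub [ffun i => h (cast_ord (esym e) i)] A)^T =
      row (cast_ord (esym e) i) (rowsub h A^T).
    by apply/rowP => j; rewrite !mxE ffunE.
  exact: row_sub.
have -> : row i (rowsub h A^T) =
    row (cast_ord e i) (colsub [ffun i => h (cast_ord (esym e) i)] A)^T.
  by apply/rowP => j; rewrite !mxE ffunE cast_ordK.
exact: row_sub.
Qed.

Lemma rank_usubmx_le m p n (A : 'M[F]_(m + p, n)) : (\rank (usubmx A) <= \rank A)%N.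
Proof. by rewrite -[X in (_ <= \rank X)%N]vsubmxK -addsmxE mxrankS// addsmxSl. Qed.

(** The block [col_mx 0 1%:M] absorbs all the rows of [dsubmx A]: a relation
    between [r] columns of [usubmx A] extends to one between the columns of the
    whole matrix. *)
Lemma not_row_full_proj m p n r (A : 'M[F]_(m + p, n)) (g : 'I_r -> 'I_n) :
  (\rank (usubmx A) < r)%N ->
  ~~ row_full (row_mx (colsub g A) (col_mx 0 (1%:M : 'M[F]_p) : 'M[F]_(m + p, p))).
Proof.
move=> lt; apply/negP => full.
have : row_full (colsub g (usubmx A)).
  apply: row_full_of_ker => c Ac.
  have E : colsub g A *m c + col_mx 0 1%:M *m - (colsub g (dsubmx A) *m c) = 0 :> 'M[F]_(m + p, 1).
    have -> : colsub g A = col_mx (colsub g (usubmx A)) (colsub g (dsubmx A)).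
      apply/matrixP => i j; rewrite mxE.
      by have [i'|i'] := split_ordP i => ->; rewrite ?col_mxEu ?col_mxEd !mxE.
    by rewrite !mul_col_mx Ac mul0mx mul1mx add_col_mx add0r subrr col_mx0.
  have := @row_full_ker _ _ _ _ (col_mx c (- (colsub g (dsubmx A) *m c))) full.
  by rewrite mul_row_col => /(_ E) /(congr1 usubmx); rewrite col_mxKu raddf0.
rewrite /row_full => /eqP rk; move: lt; rewrite -[X in (_ < X)%N]rk ltnNge => /negP; apply.
have -> : colsub g (usubmx A) = usubmx A *m colsub g 1%:M.
  by rewrite mulmx_colsub mulmx1.
exact: mxrankM_maxl.
Qed.

End RankLemmas.

(** * Jacobians of chart transitions *)

Section Jacobians.
Variable R : realType.

Lemma row_jacobian m n (f : 'rV[R]_m -> 'rV[R]_n) x i :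
  differentiable f x -> row i (jacobian f x) = 'D_(delta_mx 0 i) f x.
Proof. by move=> df; rewrite (rowE i (jacobian f x)) -deriveEjacobian. Qed.

Lemma jacobian_comp m n p (f : 'rV[R]_m -> 'rV[R]_n) (g : 'rV[R]_n -> 'rV[R]_p) x :
  differentiable f x -> differentiable g (f x) ->
  jacobian (g \o f) x = jacobian f x *m jacobian g (f x).
Proof.
move=> df dg; apply/row_matrixP => i.
have dgf : differentiable (g \o f) x by exact: differentiable_comp.
rewrite row_mul row_jacobian// [in RHS]row_jacobian// -deriveEjacobian//.
by rewrite !deriveE// diff_comp.
Qed.

Lemma jacobian_near m n (f g : 'rV[R]_m -> 'rV[R]_n) x :
  {near x, f =1 g} -> differentiable f x -> jacobian g x = jacobian f x.
Proof.
move=> fg df; apply/row_matrixP => i.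
have dg := near_eq_diff fg df.
apply: etrans (row_jacobian i dg) _; apply: etrans (esym (row_jacobian i df)).
by apply: near_eq_derive; apply: filterS fg => y ->.
Qed.

Lemma jacobian_id m x : jacobian (id : 'rV[R]_m -> 'rV[R]_m) x = 1%:M.
Proof.
apply/row_matrixP => i; rewrite row_jacobian; last exact: ex_diff.
by rewrite derive_id rowE mulmx1.
Qed.

End Jacobians.

Section Charts.
Variables (R : realType) (T : topologicalType) (n : nat).
Implicit Types (c d e : chart R T n) (y : T).

Definition transition c d := chart_to d \o chart_from c.

Lemma chart_dom_nbhs c y : chart_dom c y -> nbhs y (chart_dom c).
Proof. by move=> cy; apply: open_nbhs_nbhs; split=> //; exact: chart_dom_open. Qed.

Lemma near_chart c y (P : set T) : chart_dom c y -> nbhs y P ->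
  \forall v \near chart_to c y, chart_cod c v /\ P (chart_from c v).
Proof.
move=> cy yP; apply: filterI.
  apply: open_nbhs_nbhs; split; first exact: chart_cod_open.
  exact: chart_to_cod.
have := @chart_from_continuous _ _ _ c _ (chart_to_cod cy).
by move=> cf; apply: cf; rewrite chart_toK.
Qed.

Lemma transition_differentiable c d y : smooth_transition c d ->
  chart_dom c y -> chart_dom d y -> differentiable (transition c d) (chart_to c y).
Proof.
move=> s cy dy; apply: smooth_mx_differentiable (smooth_on_coord _ s) _.
  exact: transition_open.
by split; [exact: chart_to_cod|rewrite /= chart_toK].
Qed.

Lemma transition_comp c d e y : chart_dom c y -> chart_dom d y ->
  {near chart_to c y, transition c e =1 transition d e \o transition c d}.
Proof.
move=> cy dy; apply: filterS (near_chart cy (chart_dom_nbhs dy)) => v [cv dv].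
by rewrite /transition /= chart_toK.
Qed.

Lemma transition_to c d y : chart_dom c y -> transition c d (chart_to c y) = chart_to d y.
Proof. by move=> cy; rewrite /transition /= chart_toK. Qed.

Lemma jacobian_transition c d e y :
  smooth_transition c d -> smooth_transition d e ->
  chart_dom c y -> chart_dom d y -> chart_dom e y ->
  jacobian (transition c e) (chart_to c y) =
  jacobian (transition c d) (chart_to c y) *m jacobian (transition d e) (chart_to d y).
Proof.
move=> cd de cy dy ey.
have d1 := transition_differentiable cd cy dy; have d2 := transition_differentiable de dy ey.
have E := transition_comp e cy dy.
have d2' : differentiable (transition d e) (transition c d (chart_to c y)) by rewrite transition_to.
have nE : {near chart_to c y, transition d e \o transition c d =1 transition c e}.
  by apply: filterS E => v ->.
apply: etrans (jacobian_near nE (differentiable_comp d1 d2')) _.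
by apply: etrans (jacobian_comp d1 d2') _; rewrite (transition_to d cy).
Qed.

Lemma jacobian_transition_id c y : chart_dom c y -> jacobian (transition c c) (chart_to c y) = 1%:M.
Proof.
move=> cy; apply: etrans (jacobian_id (chart_to c y)).
apply: jacobian_near; last exact: ex_diff.
apply: filterS (near_chart cy (chart_dom_nbhs cy)) => v [cv _].
by rewrite /transition /= chart_fromK.
Qed.

Lemma jacobian_transition_unit c d y :
  smooth_transition c d -> smooth_transition d c ->
  chart_dom c y -> chart_dom d y -> jacobian (transition c d) (chart_to c y) \in unitmx.
Proof.
move=> cd dc cy dy.
exact: (mulmx1_unit (etrans (esym (jacobian_transition cd dc cy dy cy))
  (jacobian_transition_id cy))).1.
Qed.

End Charts.

(** * Tangent spaces of a submanifold in slice charts *)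

Lemma mul_mx_copidE (R : pzRingType) m n s (A : 'M[R]_(m, n)) i j :
  (A *m copid_mx s) i j = if (s <= j)%N then A i j else 0.
Proof.
rewrite mxE (bigD1 j)//= big1 ?addr0 => [|l lj].
  by rewrite !mxE !eqxx/= ltnNge; case: (leqP s j) => _; rewrite ?subr0 ?subrr ?mulr1 ?mulr0.
by rewrite !mxE (negPf lj) -[val l == val j]/(l == j) (negPf lj)/= subrr mulr0.
Qed.

Lemma mul_pid_mxE (R : pzRingType) m n s (A : 'M[R]_(m, n)) i j :
  (pid_mx s *m A) i j = if (i < s)%N then A i j else 0.
Proof.
rewrite mxE (bigD1 i)//= big1 ?addr0 => [|l li].
  by rewrite !mxE !eqxx/=; case: (ltnP i s) => _; rewrite ?mul1r ?mul0r.
by rewrite !mxE -[val i == val l]/(i == l) eq_sym (negPf li)/= mul0r.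
Qed.

Section TangentAlgebra.
Variables (F : fieldType) (n s : nat).
Hypothesis sn : (s <= n)%N.

(** [J] is invertible and preserves the coordinate subspace, so that it maps this
    subspace onto itself, and [A = J *m C]. *)
Lemma eqmx_pid_transition (A B C J : 'M[F]_n) :
  J = A *m B -> B *m C = 1%:M -> A \in unitmx ->
  (pid_mx s : 'M[F]_n) *m J *m copid_mx s = 0 ->
  ((pid_mx s : 'M[F]_n) *m A :=: (pid_mx s : 'M[F]_n) *m C)%MS.
Proof.
move=> JE BC Au T.
have AE : A = J *m C by rewrite JE -mulmxA BC mulmx1.
have Ju : J \in unitmx by rewrite JE unitmx_mul Au (mulmx1_unit BC).1.
rewrite AE mulmxA; apply: eqmxMr.
have sub : ((pid_mx s : 'M[F]_n) *m J <= (pid_mx s : 'M[F]_n))%MS.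
  have -> : (pid_mx s : 'M[F]_n) *m J = (pid_mx s : 'M[F]_n) *m J *m (pid_mx s : 'M[F]_n).
    apply/eqP; rewrite -subr_eq0 -{1}[_ *m J]mulmx1 -mulmxBr.
    by move: T; rewrite /copid_mx => ->.
  exact: submxMl.
apply/eqmxP; rewrite -(geq_leqif (mxrank_leqif_eq sub)).
by rewrite mxrankMfree // row_free_unit.
Qed.

Lemma rank_add_tangent m (A : 'M[F]_(m, n)) (C S : 'M[F]_n) : C \in unitmx ->
  (S :=: (pid_mx s : 'M[F]_n) *m C)%MS ->
  \rank (A *m C + S)%MS = (\rank (A *m copid_mx s) + s)%N.
Proof.
move=> Cu SC; rewrite -rank_add_pid//.
rewrite -[RHS](mxrankMfree _ (_ : row_free C)); last by rewrite row_free_unit.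
rewrite addsmxMr; suff -> : (A *m C + S :=: A *m C + (pid_mx s : 'M[F]_n) *m C)%MS by [].
exact: adds_eqmx (eqmx_refl _) SC.
Qed.

End TangentAlgebra.

Section TangentRank.
Variables (R : realType) (n : nat) (Y : manifold R n) (Z : submanifold Y).

Let s := sub_dim Z.

(** A transition between slice charts maps [Z] to [Z]: along a line tangent to
    the coordinate subspace, the last coordinates remain zero. *)
Lemma slice_transition_tangent z y : sub_set Z z -> sub_set Z y ->
  chart_dom (slice_at Z z) y ->
  differentiable (transition (slice_at Z y) (slice_at Z z)) (chart_to (slice_at Z y) y) ->
  (pid_mx s : 'M[R]_n) *m jacobian (transition (slice_at Z y) (slice_at Z z))
      (chart_to (slice_at Z y) y)
    *m copid_mx s = 0.
Proof.
set sy := slice_at Z y; set sz := slice_at Z z => zZ yZ zy d.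
have yy : chart_dom sy y by exact: mem_slice_at.
apply/matrixP => i l; rewrite mul_mx_copidE mul_pid_mxE [RHS]mxE.
case: ifP => // sl; case: ifP => // is_.
set w := chart_to sy y in d *.
have E : forall A : 'M[R]_n, A i l = ((delta_mx 0 i : 'rV[R]_n) *m A) 0 l.
  by move=> A; rewrite -rowE mxE.
rewrite E -deriveEjacobian// coord_derive; last exact: diff_derivable.
apply/lim_near_cst => //=; apply: cvg_within.
have nw : \forall v \near w, chart_cod sy v /\ chart_dom sz (chart_from sy v).
  exact: near_chart yy (chart_dom_nbhs zy).
have w0 : transition sy sz w 0 l = 0.
  by rewrite /transition /= chart_toK//; exact: (slice_atP zZ zy).1.
have c : (h *: delta_mx 0 i + w : 'rV[R]_n) @[h --> (0 : R)] --> w.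
  rewrite -[X in _ --> X]add0r -(scale0r (delta_mx 0 i : 'rV[R]_n)).
  by apply: cvgD; [exact: scalel_continuous|exact: cvg_cst].
have := c _ nw; apply: (@filterS _ (nbhs (0 : R))) => h [/= cv dv].
rewrite w0 subr0 -[RHS](scaler0 _ h^-1); congr (_ *: _).
apply: (slice_atP zZ dv).1 => //.
apply: (slice_atP yZ (chart_from_dom cv)).2 => j sj.
rewrite chart_fromK// !mxE (_ : j == i = false) ?andbF ?mulr0 ?add0r.
  exact: (slice_atP yZ yy).1.
by apply/negbTE; apply: contraTneq sj => ->; rewrite -ltnNge.
Qed.

(** By [slice_transition_tangent], the slice chart used to compute the tangent
    space of [Z] at [y] does not matter. Hence one slice chart serves for all the
    points of [Z] in its domain. *)
Lemma sub_tangent_slice z y : sub_set Z z -> sub_set Z y ->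
  chart_dom (slice_at Z z) y ->
  (sub_tangent Z y :=: (pid_mx s : 'M[R]_n) *m
    jacobian (transition (slice_at Z z) (chart_at y)) (chart_to (slice_at Z z) y))%MS.
Proof.
set sy := slice_at Z y; set sz := slice_at Z z; set cy := chart_at y => zZ yZ zy.
have yy : chart_dom sy y by exact: mem_slice_at.
have yc : chart_dom cy y by exact: mem_chart_at.
have [sc cs] := @slice_at_smooth _ _ _ Z y y yZ.
have [tc ct] := @slice_at_smooth _ _ _ Z z y zZ.
have dt : differentiable (transition sy sz) (chart_to sy y).
  apply: near_eq_diff (_ : differentiable (transition cy sz \o transition sy cy) _); last first.
    apply: differentiable_comp; first exact: transition_differentiable.
    by rewrite transition_to//; exact: transition_differentiable.
  by apply: filterS (transition_comp sz yy yc) => v ->.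
have -> : sub_tangent Z y = (pid_mx s : 'M[R]_n) *m
    jacobian (transition sy cy) (chart_to sy y) by [].
exact: (eqmx_pid_transition (jacobian_transition sc ct yy yc zy)
  (etrans (esym (jacobian_transition ct tc yc zy yc)) (jacobian_transition_id yc))
  (jacobian_transition_unit sc cs yy yc) (slice_transition_tangent zZ yZ zy dt)).
Qed.

(** In the slice chart around [z], the tangent spaces of [Z] become the fixed
    coordinate subspace, and [delta] only depends on the rank of the derivative
    of the last [n - s] coordinates of the map. *)
Lemma delta_slice M N (X : manifold R M) (D : set X) (f : D -> Y) (x : D) z
    (H : 'rV[R]_N -> 'rV[R]_n) (theta : 'rV[R]_M -> 'rV[R]_N) :
  let c := chart_at (val x) in let v0 := chart_to c (val x) in
  let sz := slice_at Z z in
  sub_set Z z -> sub_set Z (f x) -> chart_dom sz (f x) ->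
  differentiable theta v0 -> differentiable H (theta v0) ->
  H (theta v0) = chart_to sz (f x) ->
  {near v0, local_rep f c (chart_at (f x)) =1 transition sz (chart_at (f x)) \o H \o theta} ->
  delta f Z x =
    (n - (\rank (jacobian theta v0 *m jacobian H (theta v0) *m copid_mx s) + s))%N.
Proof.
move=> c v0 sz zZ yZ zy dth dH Hy nE; set y := f x in yZ zy Hy nE *.
have [tc ct] := @slice_at_smooth _ _ _ Z z y zZ.
have yc : chart_dom (chart_at y) y by exact: mem_chart_at.
have dHt : differentiable (H \o theta) v0 by exact: differentiable_comp.
have ds : differentiable (transition sz (chart_at y)) ((H \o theta) v0).
  by rewrite /= Hy; exact: transition_differentiable.
have d3 : differentiable (transition sz (chart_at y) \o (H \o theta)) v0.
  exact: differentiable_comp.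
rewrite /delta -/y mem_set//; congr (n - _)%N.
have nE' : {near v0, transition sz (chart_at y) \o (H \o theta) =1 local_rep f c (chart_at y)}.
  by apply: filterS nE => v ->.
have Js : jacobian (transition sz (chart_at y)) ((H \o theta) v0) =
    jacobian (transition sz (chart_at y)) (chart_to sz y) by rewrite /= Hy.
have DE : differential f x = jacobian theta v0 *m jacobian H (theta v0) *m
    jacobian (transition sz (chart_at y)) (chart_to sz y).
  apply: etrans (jacobian_near nE' d3) _; apply: etrans (jacobian_comp dHt ds) _.
  exact: (congr2 mulmx (jacobian_comp dth dH) Js).
rewrite DE; apply: rank_add_tangent; first exact: sub_dim_le.
  exact: jacobian_transition_unit tc ct zy yc.
exact: sub_tangent_slice zZ yZ zy.
Qed.

End TangentRank.

Section Transverse.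
Variables (R : realType) (m n : nat) (X : manifold R m) (Y : manifold R n).
Variables (D : set X) (f : D -> Y) (Z : submanifold Y).

Lemma transverse_at_delta (x : D) : transverse_at f Z x <-> delta f Z x = 0%N.
Proof.
rewrite /transverse_at /delta; case: ifPn => [/set_mem|/negP] fZ; last first.
  by split=> // _; left => h; apply: fZ; exact: mem_set.
set A := (_ + _)%MS; split=> [[//|[_ ->]]|]; first by rewrite mxrank1 subnn.
move=> /eqP; rewrite subn_eq0 => nA; right; split=> //.
by apply/eqmxP; rewrite submx1 sub1mx /row_full eqn_leq nA rank_leq_col.
Qed.

Lemma delta_notin (x : D) : ~ sub_set Z (f x) -> delta f Z x = 0%N.
Proof. by move=> nZ; rewrite /delta; case: ifPn => // /set_mem. Qed.

End Transverse.

(** * Smooth maps between manifolds in charts *)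

Lemma rank_unit_mulmx (K : fieldType) m n (P : 'M[K]_m) (M : 'M[K]_(m, n)) :
  P \in unitmx -> \rank (P *m M) = \rank M.
Proof. by move=> Pu; rewrite eqmxMfull// row_full_unit. Qed.

Section LocalRep.
Variables (R : realType) (m n : nat) (X : manifold R m) (Y : manifold R n).
Variables (D : set X) (f : D -> Y).

Lemma local_repE (c : chart R X m) (d : chart R Y n) v (u : D) :
  val u = chart_from c v -> local_rep f c d v = chart_to d (f u).
Proof. by move=> uv; rewrite /local_rep -uv valK. Qed.

Lemma nbhs_dom (u : D) (P : set Y) : open D -> continuous f -> nbhs (f u) P ->
  \forall q \near val u, exists2 u' : D, val u' = q & P (f u').
Proof.
move=> oD cf /cf [_ /= [[W oW <-] /= Wu sub]].
have : nbhs (val u) (W `&` D).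
  apply: filterI; first by apply: open_nbhs_nbhs.
  by apply: open_nbhs_nbhs; split=> //; apply: set_mem; exact: valP.
apply: filterS => q [Wq /mem_set Dq].
by exists (exist _ q Dq) => //; exact: sub.
Qed.

Definition rep_dom (c : chart R X m) (P : set Y) : set 'rV[R]_m :=
  chart_cod c `&` [set v | exists2 u : D, val u = chart_from c v & P (f u)].

Lemma rep_dom_open c (P : set Y) : open D -> continuous f -> open P ->
  open (rep_dom c P).
Proof.
move=> oD cf oP; rewrite openE => v [cv [u uv Pu]].
have cu : chart_dom c (val u) by rewrite uv; exact: chart_from_dom.
have nP : nbhs (f u) P by exact: open_nbhs_nbhs.
have := near_chart cu (nbhs_dom oD cf nP).
by rewrite uv chart_fromK.
Qed.

Lemma smooth_local_rep x y (d : chart R Y n) : open D -> smooth_map f ->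
  smooth_transition (chart_at y) d ->
  smooth_mx (rep_dom (chart_at x) (chart_dom (chart_at y) `&` chart_dom d))
    (local_rep f (chart_at x) d).
Proof.
move=> oD [cf sf] yd; set c := chart_at x; set cy := chart_at y; set O := rep_dom _ _.
have oO : open O.
  by apply: rep_dom_open => //; apply: openI; exact: chart_dom_open.
have oO1 : open (rep_dom c (chart_dom cy)).
  by apply: rep_dom_open => //; exact: chart_dom_open.
have s1 : smooth_mx (rep_dom c (chart_dom cy)) (local_rep f c cy).
  exact: smooth_on_coord oO1 (sf x y).
have o2 : open (chart_cod cy `&` chart_from cy @^-1` chart_dom d).
  exact: transition_open.
have s2 := smooth_on_coord o2 yd.
move=> i j.
have O1 : O `<=` rep_dom c (chart_dom cy) by move=> v [cv [u uv [uy _]]]; split=> //; exists u.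
have s : smooth O ((fun w => transition cy d w i j) \o local_rep f c cy).
  apply: smooth_comp oO _ _ (s2 i j).
    move=> v [cv [u uv [uy ud]]]; rewrite (local_repE cy uv).
    by split; [exact: chart_to_cod|rewrite /= chart_toK].
  by move=> a b; exact: smooth_sub O1 (s1 a b).
apply: smooth_ext s => // v [cv [u uv [uy ud]]].
by rewrite /= (local_repE cy uv) (local_repE d uv) transition_to.
Qed.

End LocalRep.

Section Corollary.
Variables (R : realType) (m p n : nat).
Variables (X : manifold R m) (A : manifold R p) (Y : manifold R n).
Variable Z : submanifold Y.
Variables (U : set (prod_manifold X A)) (oU : open U).
Variables (F : U -> Y) (smoothF : smooth_map F).

Let s := sub_dim Z.

Lemma slice_mapE (u : U) (x : ysection U (val u).2) :
  val x = (val u).1 -> slice_map F x = F u.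
Proof.
move=> xu; rewrite /slice_map; congr F; apply: val_inj => /=.
by rewrite xu -surjective_pairing.
Qed.

Section Local.
Variables (x0 : X) (a0 : A) (y0 : Y).
Hypothesis y0Z : sub_set Z y0.

Let c0 := @chart_at _ _ (prod_manifold X A) (x0, a0).
Let s0 := slice_at Z y0.
Let Om := rep_dom F c0 (chart_dom (chart_at y0) `&` chart_dom s0).
Let H := local_rep F c0 s0.

Lemma local_domain_open : open Om.
Proof.
apply: rep_dom_open => //; first by case: smoothF.
by apply: openI; exact: chart_dom_open.
Qed.

Lemma smooth_slice_rep : smooth_mx Om H.
Proof.
apply: smooth_local_rep => //.
by have [] := @slice_at_smooth _ _ _ Z y0 y0 y0Z.
Qed.

Variable u : U.
Let q := val u.
Hypotheses (cq : chart_dom c0 q) (uOm : Om (chart_to c0 q)) (uZ : sub_set Z (F u)).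

Let su : chart_dom s0 (F u).
Proof.
have [_ [u']] := uOm; rewrite chart_toK// => uu' [_].
by rewrite (val_inj uu').
Qed.

Let dH : differentiable H (chart_to c0 q).
Proof. exact: smooth_mx_differentiable smooth_slice_rep uOm. Qed.

Let Hq : H (chart_to c0 q) = chart_to s0 (F u).
Proof. by apply: local_repE; rewrite chart_toK. Qed.

Let near_u : \forall q' \near q, chart_dom c0 q' /\
  exists2 u' : U, val u' = q' & chart_dom s0 (F u').
Proof.
apply: filterI; first exact: chart_dom_nbhs.
apply: (@nbhs_dom R _ _ (prod_manifold X A) Y U F u) => //.
  by case: smoothF.
exact: chart_dom_nbhs.
Qed.

Lemma delta_total : delta F Z u =
  (n - (\rank (Jac H (chart_to c0 q) *m copid_mx s) + s))%N.
Proof.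
set cqq := chart_at q; have qq : chart_dom cqq q by exact: mem_chart_at.
have t0 : transition cqq c0 (chart_to cqq q) = chart_to c0 q by rewrite transition_to.
have dth : differentiable (transition cqq c0) (chart_to cqq q).
  by apply: transition_differentiable => //; exact: chart_at_smooth.
rewrite (@delta_slice _ _ _ Z _ _ _ _ _ u y0 H (transition cqq c0)) //; last first.
- apply: filterS (near_chart qq near_u) => v [cv [c0v [u' u'v su']]].
  rewrite (local_repE _ _ u'v) /= (_ : H _ = chart_to s0 (F u')); last first.
    by apply: local_repE; rewrite u'v; exact: esym (chart_toK c0v).
  by rewrite /transition /= chart_toK.
- by rewrite t0.
- by rewrite t0.
rewrite t0 -(jacobian_Jac dH) -mulmxA; congr (n - (_ + _))%N.
apply: rank_unit_mulmx.
by apply: jacobian_transition_unit => //; exact: chart_at_smooth.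
Qed.

Lemma delta_fibre (x : ysection U q.2) : val x = q.1 ->
  delta (@slice_map _ _ _ _ _ _ _ _ F q.2) Z x =
  (n - (\rank (usubmx (Jac H (chart_to c0 q) *m copid_mx s)) + s))%N.
Proof.
move=> xq; have fx : slice_map F x = F u by exact: slice_mapE.
set cx := chart_at (val x); have xx : chart_dom cx (val x) by exact: mem_chart_at.
have c1 : chart_dom (chart_at x0) (val x) by rewrite xq; case: cq.
have c2 : chart_dom (chart_at a0) q.2 by case: cq.
(* The inclusion of the fibre over [q.2], read in charts. *)
pose th v : 'rV[R]_(m + p) := row_mx (transition cx (chart_at x0) v) (chart_to (chart_at a0) q.2).
have t0 : th (chart_to cx (val x)) = chart_to c0 q by rewrite /th transition_to// xq.
have dtr : differentiable (transition cx (chart_at x0)) (chart_to cx (val x)).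
  by apply: transition_differentiable => //; exact: chart_at_smooth.
have dth : differentiable th (chart_to cx (val x)).
  apply: differentiable_rV => j; have [j'|j'] := split_ordP j => ->.
    rewrite (_ : (fun _ => _) = (fun v => transition cx (chart_at x0) v 0 j')).
      apply: (differentiable_comp dtr (differentiable_coord _ _ _)).
    by apply/funext => v; rewrite row_mxEl.
  rewrite (_ : (fun _ => _) = cst (chart_to (chart_at a0) q.2 0 j')).
    exact: differentiable_cst.
  by apply/funext => v; rewrite row_mxEr.
have Jth : jacobian th (chart_to cx (val x)) =
    row_mx (jacobian (transition cx (chart_at x0)) (chart_to cx (val x))) 0.
  apply: etrans (jacobian_Jac dth) _; apply: etrans (Jac_row_mx _ _ _) _.
  congr row_mx; first exact: esym (jacobian_Jac dtr).
  by apply/matrixP => i j; rewrite !mxE derive_cst.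
rewrite (@delta_slice _ _ _ Z _ _ _ _ _ x y0 H th) ?fx//; last first.
- have cv : {for val x, continuous (fun x' : X => (x', q.2) : prod_manifold X A)}.
    apply: (@cvg_pair _ _ _ _ (nbhs (val x))); [exact: cvg_id|exact: cvg_cst].
  have nq : nbhs ((val x, q.2) : prod_manifold X A) [set q' | chart_dom c0 q' /\
      exists2 u' : U, val u' = q' & chart_dom s0 (F u')].
    by rewrite xq -surjective_pairing.
  apply: filterS (near_chart xx (cv _ nq)) => v [cv' [[c0v _] [u' u'v su']]].
  have mx : chart_from cx v \in ysection U q.2.
    by rewrite mem_ysection -u'v; exact: valP.
  pose x' : ysection U q.2 := exist _ (chart_from cx v) mx.
  have fE : slice_map F x' = F u'.
    by rewrite /slice_map; congr F; apply: val_inj; exact: esym u'v.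
  rewrite (local_repE _ _ (_ : val x' = chart_from cx v))// fE.
  have HE : H (th v) = chart_to s0 (F u').
    apply: local_repE; rewrite u'v /c0 /= /th row_mxKl row_mxKr.
    by rewrite /transition /= !chart_toK.
  apply: etrans (esym (congr1 (transition s0 (chart_at (F u))) HE)).
  by rewrite /transition /= chart_toK.
- by rewrite t0.
- by rewrite t0.
rewrite Jth t0 -(jacobian_Jac dH); congr (n - (_ + _))%N.
set JH := jacobian H _; rewrite -[JH in LHS]vsubmxK mul_row_col mul0mx addr0 -mulmxA.
have -> : usubmx (JH *m copid_mx s) = usubmx JH *m copid_mx s.
  by rewrite -{1}[JH]vsubmxK mul_col_mx col_mxKu.
apply: rank_unit_mulmx.
by apply: jacobian_transition_unit => //; exact: chart_at_smooth.
Qed.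

End Local.
End Corollary.

(** * Points where the rank drops along the fibres *)

Section RankDrop.
Variables (R : realType) (m p n s : nat).
Variables (Om : set 'rV[R]_(m + p)) (H : 'rV[R]_(m + p) -> 'rV[R]_n).
Hypotheses (oOm : open Om) (sH : smooth_mx Om H).

Lemma derive_coord N (j : 'I_N) (x v : 'rV[R]_N) : 'D_v (fun y : 'rV[R]_N => y 0 j) x = v 0 j.
Proof. by rewrite -(@coord_derive _ _ _ id)// derive_id. Qed.

Lemma Jac_rsubmx x :
  Jac (rsubmx : 'rV[R]_(m + p) -> 'rV[R]_p) x = col_mx 0 1%:M.
Proof.
apply/matrixP => i j; rewrite mxE.
rewrite (_ : (fun _ => _) = (fun y : 'rV[R]_(m + p) => y 0 (rshift m j))); last first.
  by apply/funext => y; rewrite mxE.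
rewrite derive_coord mxE eqxx /=; have [i'|i'] := split_ordP i => ->.
  by rewrite col_mxEu mxE eq_rlshift.
by rewrite col_mxEd mxE eq_rshift eq_sym.
Qed.

(** Let [r] be the rank at [v], and select [r] independent columns. The chosen
    coordinates of [H] define a level set through [v] with regular equations. As
    the rank along the fibre is less than [r], [v] is a critical point of the
    projection to the parameters on this level set. There are countably many
    choices of [r] and of the columns, so Sard's theorem concludes. *)
Lemma null_rank_drop : lebesgue_null (rsubmx @` [set v | [/\ Om v,
    H v *m copid_mx s = 0 &
    (\rank (usubmx (Jac H v *m copid_mx s)) < \rank (Jac H v *m copid_mx s))%N]]).
Proof.
pose G r (g : {ffun 'I_r -> 'I_n}) v := colsub g (H v *m copid_mx s).
have sG r (g : {ffun 'I_r -> 'I_n}) : smooth_mx Om (G r g).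
  move=> i j.
  apply: smooth_ext (smooth_mulmx oOm sH (@smooth_mx_cst _ _ Om _ _ (copid_mx s)) i (g j)) => // x _.
  by rewrite [RHS]mxE.
have JG r (g : {ffun 'I_r -> 'I_n}) v : Jac (G r g) v = colsub g (Jac H v *m copid_mx s).
  apply/matrixP => i j; rewrite [LHS]mxE [RHS]mxE mul_mx_copidE.
  rewrite (_ : (fun _ => _) = (fun y => if (s <= g j)%N then H y 0 (g j) else 0)); last first.
    by apply/funext => y; rewrite mxE mul_mx_copidE.
  by case: ifP => _; [rewrite mxE|rewrite derive_cst].
have srs : smooth_mx Om (rsubmx : 'rV[R]_(m + p) -> 'rV[R]_p).
  move=> i j; apply: smooth_ext (@smooth_coord _ _ Om (rshift m j)) => // y _.
  by rewrite mxE (ord1 i).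
apply: nullS (null_bigcup (fun r : nat => null_bigcup (fun g : {ffun 'I_r -> 'I_n} =>
  sard oOm (sG r g) srs))).
move=> _ [v [Ov Hv lt] <-]; have [g full] := row_full_colsub (Jac H v *m copid_mx s).
exists (\rank (Jac H v *m copid_mx s)) => //; exists g => //; exists v => //; split=> //.
- by rewrite /G Hv; apply/matrixP => i j; rewrite !mxE.
- by rewrite JG.
by rewrite JG Jac_rsubmx; exact: not_row_full_proj.
Qed.

End RankDrop.

(** * Generic transversality *)

Lemma mul_copid_eq0 (R : pzRingType) n s (v : 'rV[R]_n) :
  (forall i : 'I_n, (s <= i)%N -> v 0 i = 0) -> v *m copid_mx s = 0.
Proof.
by move=> H; apply/rowP => j; rewrite mul_mx_copidE [RHS]mxE; case: ifP => // /H.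
Qed.

Theorem corollary1 (R : realType) (m p n : nat)
    (X : manifold R m) (A : manifold R p) (Y : manifold R n)
    (Z : submanifold Y)
    (U : set (prod_manifold X A)) (oU : open U)
    (F : U -> Y) (smoothF : smooth_map F) :
  measure_zero_in (snd @` U) (snd @` degenerate_set F Z) <->
  generically_transverse F Z.
Proof.
split=> [[_ nullW]|[Sigma [[_ nS] transF]]]; last first.
  split=> [_ [q [u [x [uq _ _ _]]] <-]|a].
    by exists q => //; rewrite -uq; apply: set_mem; exact: valP.
  apply: nullS (nS a) => _ [b [ab [q [u [x [uq xq dE d0]]] qb]] <-].
  exists b; last by []; split; first exact: ab.
  apply: contrapT => nb.
  have Ub : (snd @` U) b.
    by exists q; [rewrite -uq; exact: set_mem (valP u)|exact: qb].
  have := transF b (conj Ub nb); rewrite -qb => /(_ x) /transverse_at_delta.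
  by rewrite dE => dF; rewrite dF in d0.
exists [set a | (snd @` U) a /\ ~ transverse (@slice_map _ _ _ _ _ _ _ _ F a) Z].
split; last by move=> a [Ua nT]; apply: contrapT => nt; apply: nT.
split=> [a []//|a0].
(* The points where passing to the fibre lowers the rank. They are read in the
   chart at [a0], the one in which nullity has to be shown. *)
pose E := [set q : prod_manifold X A | chart_dom (chart_at a0) q.2 /\
  exists (u : U) (x : ysection U q.2), [/\ val u = q, val x = q.1 &
    delta (@slice_map _ _ _ _ _ _ _ _ F q.2) Z x <> delta F Z u]].
have nE : lebesgue_null ((fun q : prod_manifold X A => chart_to (chart_at a0) q.2) @` E).
  apply: null_of_locally; first exact: manifold_countable.
  move=> q0 [a0q0 [u0 [x0 [uq0 xq0 ne]]]].
  have fx0 : slice_map F x0 = F u0.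
    by move: x0 xq0 ne; rewrite -uq0 => x0 xq0 _; exact: slice_mapE.
  have u0Z : sub_set Z (F u0).
    apply: contrapT => nZ; apply: ne.
    by apply: etrans (esym (delta_notin nZ)); apply: delta_notin; rewrite fx0.
  set y0 := F u0 in u0Z.
  pose c0 := @chart_at _ _ (prod_manifold X A) (q0.1, a0).
  pose Om := rep_dom F c0 (chart_dom (chart_at y0) `&` chart_dom (slice_at Z y0)).
  pose H := local_rep F c0 (slice_at Z y0).
  have c0q0 : chart_dom c0 q0 by split; [exact: mem_chart_at|exact: a0q0].
  have y0d : nbhs y0 (chart_dom (chart_at y0) `&` chart_dom (slice_at Z y0)).
    apply: filterI; apply: chart_dom_nbhs; first exact: mem_chart_at.
    exact: mem_slice_at.
  exists [set q | chart_dom c0 q /\ Om (chart_to c0 q)].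
    have := @nbhs_dom R _ _ (prod_manifold X A) Y U F u0 _ oU (proj1 smoothF) y0d.
    rewrite uq0; apply: filterS2 (chart_dom_nbhs c0q0) => q cq [u uq Pu].
    split; first exact: cq.
    split; first exact: chart_to_cod.
    by exists u; [exact: etrans uq (esym (chart_toK cq))|exact: Pu].
  have oOm : open Om by exact: local_domain_open.
  have sH : smooth_mx Om H by exact: smooth_slice_rep.
  apply: nullS (null_rank_drop (sub_dim Z) oOm sH).
  move=> _ [q [[a0q [u [x [uq xq neq]]]] [cq Oq]] <-].
  exists (chart_to c0 q); last by rewrite /c0 /= row_mxKr.
  subst q; have fx : slice_map F x = F u by exact: slice_mapE.
  have uZ : sub_set Z (F u).
    apply: contrapT => nZ; apply: neq.
    by apply: etrans (esym (delta_notin nZ)); apply: delta_notin; rewrite fx.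
  split; first exact: Oq.
    rewrite /H (local_repE _ _ (_ : val u = _)); last by rewrite (chart_toK cq).
    have [_ [u' uu' [_ su']]] := Oq; rewrite (chart_toK cq) in uu'.
    rewrite (val_inj uu') in su'.
    by apply: mul_copid_eq0; exact: (slice_atP u0Z su').1.
  have := neq; rewrite (delta_total oU smoothF u0Z cq Oq uZ).
  rewrite (delta_fibre oU smoothF u0Z cq Oq uZ xq) -/H => ne'.
  rewrite ltn_neqAle rank_usubmx_le andbT; apply/eqP => e; apply: ne'.
  by rewrite e.
apply: nullS (null_setU (nullW a0) nE).
move=> _ [a [a0a [Ua nt]] <-].
have [x] := (existsNP _).2 nt.
move=> /transverse_at_delta dx.
have mu : (val x, a) \in U by rewrite -mem_ysection; exact: valP.
pose u : U := exist _ (val x, a) mu.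
have [de|dne] := eqVneq (delta (@slice_map _ _ _ _ _ _ _ _ F a) Z x) (delta F Z u).
  left; exists a; last by []; split; first exact: a0a.
  exists (val x, a); last by []; exists u, x; split; [by []|by []|exact: de|].
  by rewrite -de lt0n; apply/eqP.
right; exists (val x, a); last by []; split; first exact: a0a.
by exists u, x; split; [| |exact/eqP].
Qed.
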